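(* Let $\lambda,\omega>0$. Then there exist sequences $(s_n)\subset\mathbb R$ and $(g_n)\subset L^2(\mathbb R^3)^3$ with $g_n\neq0$, and a sequence $(v_n,p_n)\subset W^{2,2}_{\mathrm{loc}}(\mathbb R^3)^3\times W^{1,2}_{\mathrm{loc}}(\mathbb R^3)$ of solutions to $$ is_nv_n+\omega\,\mathcal R v_n-\Delta v_n-\lambda\partial_1v_n+\nabla p_n=g_n,\qquad \operatorname{div}v_n=0\qquad\text{in }\mathbb R^3, $$ such that $\nabla^2v_n,\ is_nv_n+\omega\mathcal R v_n,\ \partial_1v_n\in L^2(\mathbb R^3)$ and $$ \|is_nv_n+\omega\mathcal R v_n\|_2\ge C\,n^{1/2}\,\|g_n\|_2 $$ for a constant $C>0$ independent of $n$. Moreover, for any $\alpha>0$ such that $\alpha/\omega\notin\mathbb Q$, one can choose $(s_n)\subset\alpha\mathbb Z$ with $\operatorname{dist}(s_n,\omega\mathbb Z)\to0$ as $n\to\infty$.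
   Context: Functions are complex valued and $\|\cdot\|_2$ is the $L^2(\mathbb R^3)$ norm. $e_1=(1,0,0)$, $\wedge$ is the vector product in $\mathbb R^3$, and $$\mathcal R v:=e_1\wedge v-(e_1\wedge x)\cdot\nabla v,\qquad (e_1\wedge x)\cdot\nabla v=\sum_{j=1}^3(e_1\wedge x)_j\,\partial_jv .$$ $\nabla^2v$ is the collection of all second-order derivatives. *)

(* Defs.v *)
From mathcomp Require Import all_boot all_order all_algebra.
From mathcomp Require Import all_classical all_reals all_analysis.
From mathcomp.real_closed Require Import complex.

Set Implicit Arguments.
Unset Strict Implicit.
Unset Printing Implicit Defensive.

Import Order.TTheory GRing.Theory Num.Theory.
Import numFieldNormedType.Exports.

Local Open Scope classical_set_scope.
Local Open Scope complex_scope.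
Local Open Scope ring_scope.

(* measurableTypeR R is R with the sigma-algebra on which lebesgue_measure
   lives; topology and differentiation on R^3 are those of the normed module
   R * R * R, to which R3 R unfolds. *)
Notation R3 R := (measurableTypeR R * measurableTypeR R * measurableTypeR R)%type.

Definition mu3 (R : realType) : {measure set (R3 R) -> \bar R} :=
  ((@lebesgue_measure R \x @lebesgue_measure R) \x @lebesgue_measure R)%E.

(* Coordinates are numbered 0, 1, 2. *)
Definition coords (R : realType) (x : R3 R) : 'rV[R]_3 :=
  \row_j [:: x.1.1; x.1.2; x.2]`_j.

Definition basis3 (R : realType) (j : 'I_3) : R3 R :=
  ((j == 0)%:R, (j == 1)%:R, (j == 2)%:R).

(* 'I_3 is the ring Z/3Z, so j + 1 and j + 2 are taken modulo 3. *)
Definition cross (K : pzRingType) (u w : 'rV[K]_3) : 'rV[K]_3 :=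
  \row_j (u 0 (j + 1) * w 0 (j + 2) - u 0 (j + 2) * w 0 (j + 1)).

Definition e1 (K : pzRingType) : 'rV[K]_3 := delta_mx 0 0.

Definition pd (R : realType) (j : 'I_3) (phi : R3 R -> R) : R3 R -> R :=
  fun x => 'D_(basis3 R j) phi x.

(* C_c^oo(R^3): all iterated partial derivatives of phi are differentiable. *)
Definition test_fun (R : realType) (phi : R3 R -> R) : Prop :=
  (forall (js : seq 'I_3) (x : R3 R), differentiable (foldr (@pd R) phi js) x)
  /\ compact (closure [set x | phi x != 0]).

Definition cmeasurable (R : realType) (f : R3 R -> R[i]) : Prop :=
  measurable_fun setT (fun x => complex.Re (f x)) /\
  measurable_fun setT (fun x => complex.Im (f x)).

Definition cabs (R : realType) (z : R[i]) : R := ComplexField.Normc.normc z.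

Definition cintegral (R : realType) (f : R3 R -> R[i]) : R[i] :=
  (\int[mu3 R]_x complex.Re (f x)) +i* (\int[mu3 R]_x complex.Im (f x)).

Definition L2 (R : realType) (f : R3 R -> R[i]) : Prop :=
  cmeasurable f /\ ('N[mu3 R]_2%:E [(fun x => (cabs (f x))%:E)] < +oo)%E.

Definition L2loc (R : realType) (f : R3 R -> R[i]) : Prop :=
  cmeasurable f /\
  forall K : set (R3 R), compact K ->
    (\int[mu3 R]_(x in K) (cabs (f x) ^+ 2)%:E < +oo)%E.

(* w is the weak derivative d_j u, for u and w locally integrable. Real-valued
   test functions suffice, both sides being linear in phi. *)
Definition weak_pd (R : realType) (j : 'I_3) (u w : R3 R -> R[i]) : Prop :=
  forall phi : R3 R -> R, test_fun phi ->
    cintegral (fun x => u x * (pd j phi x)%:C) =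
    - cintegral (fun x => w x * (phi x)%:C).

(* u is in W^{1,2}_loc, and its weak derivative d_j u is Du j. *)
Definition W12loc (R : realType) (u : R3 R -> R[i])
    (Du : 'I_3 -> R3 R -> R[i]) : Prop :=
  L2loc u /\ forall j, L2loc (Du j) /\ weak_pd j u (Du j).

(* u is in W^{2,2}_loc, d_j u is Du j, and d_k d_j u is D2u k j. *)
Definition W22loc (R : realType) (u : R3 R -> R[i])
    (Du : 'I_3 -> R3 R -> R[i]) (D2u : 'I_3 -> 'I_3 -> R3 R -> R[i]) : Prop :=
  W12loc u Du /\ forall j, W12loc (Du j) (fun k => D2u k j).

Definition vfield (R : realType) := R3 R -> 'rV[R[i]]_3.

Definition vcomp (R : realType) (l : 'I_3) (v : vfield R) : R3 R -> R[i] :=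
  fun x => v x 0 l.

Definition W22locv (R : realType) (v : vfield R) (Dv : 'I_3 -> vfield R)
    (D2v : 'I_3 -> 'I_3 -> vfield R) : Prop :=
  forall l, W22loc (vcomp l v) (fun j => vcomp l (Dv j))
              (fun k j => vcomp l (D2v k j)).

Definition L2v (R : realType) (f : vfield R) : Prop := forall l, L2 (vcomp l f).

Definition L2norm (R : realType) (f : vfield R) : \bar R :=
  'N[mu3 R]_2%:E [(fun x => (Num.sqrt (\sum_l cabs (f x 0 l) ^+ 2))%:E)].

(* R v = e_1 /\ v - (e_1 /\ x) . nabla v, where Dv j stands for d_j v. *)
Definition rotop (R : realType) (v : vfield R) (Dv : 'I_3 -> vfield R)
    : vfield R :=
  fun x => cross (e1 R[i]) (v x)
           - \sum_j (cross (e1 R) (coords x) 0 j)%:C *: Dv j x.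

(* i s v + omega R v *)
Definition isrot (R : realType) (omega s : R) (v : vfield R)
    (Dv : 'I_3 -> vfield R) : vfield R :=
  fun x => (0 +i* s) *: v x + omega%:C *: rotop v Dv x.

(* Both equations hold almost everywhere in R^3. *)
Definition oseen_sol (R : realType) (lambda omega s : R) (v : vfield R)
    (Dv : 'I_3 -> vfield R) (D2v : 'I_3 -> 'I_3 -> vfield R)
    (Dp : 'I_3 -> R3 R -> R[i]) (g : vfield R) : Prop :=
  {ae mu3 R, forall x,
    isrot omega s v Dv x - \sum_j D2v j j x - lambda%:C *: Dv 0 x
      + \row_j Dp j x = g x} /\
  {ae mu3 R, forall x, \sum_j Dv j x 0 j = 0}.

Definition nonzero_field (R : realType) (g : vfield R) : Prop :=
  ~ {ae mu3 R, forall x, g x = 0}.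

(* There are g_n, v_n, p_n (together with the weak derivatives of v_n and p_n)
   and C > 0 for the given sequence (s_n). *)
Definition counterexample (R : realType) (lambda omega : R) (s : nat -> R)
    : Prop :=
  exists (g v : nat -> vfield R) (p : nat -> R3 R -> R[i])
    (Dv : nat -> 'I_3 -> vfield R) (D2v : nat -> 'I_3 -> 'I_3 -> vfield R)
    (Dp : nat -> 'I_3 -> R3 R -> R[i]),
  (forall n,
    [/\ L2v (g n) /\ nonzero_field (g n),
        W22locv (v n) (Dv n) (D2v n) /\ W12loc (p n) (Dp n),
        oseen_sol lambda omega (s n) (v n) (Dv n) (D2v n) (Dp n) (g n) &
        [/\ forall j k, L2v (D2v n j k),
            L2v (isrot omega (s n) (v n) (Dv n)) &
            L2v (Dv n 0)]]) /\
  exists2 C : R, 0 < C &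
    forall n, ((C * Num.sqrt n%:R)%:E * L2norm (g n)
               <= L2norm (isrot omega (s n) (v n) (Dv n)))%E.

Definition multiples (R : realType) (a : R) : set R :=
  [set a * z%:~R | z in [set: int]].

Definition dist (R : realType) (x : R) (A : set R) : R :=
  inf [set `|x - a| | a in A].

(* Main.v *)
From HB Require Import structures.
Require Import Defs.
From mathcomp Require Import all_boot all_order all_algebra.
From mathcomp Require Import all_classical all_reals all_analysis.
From mathcomp.real_closed Require Import complex.
From mathcomp Require Import measurable_realfun ring lra.

Import Order.TTheory GRing.Theory Num.Theory.
Import numFieldNormedType.Exports.

Local Open Scope classical_set_scope.
Local Open Scope ring_scope.

(** The operator i s v + omega R v is resonant: a field v with R v = - i K v is
multiplied by i (s - omega K), which is small but nonzero when s is close to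
omega K. Write s = omega K + delta and kappa = delta / lambda. For such a
solenoidal v and p = 0 the system becomes
  g = i delta v - Delta v - lambda d_1 v,
whose Fourier symbol is |xi|^2 + i (delta - lambda xi_1). It nearly vanishes at
xi = (kappa, 0, 0), where only |xi|^2 = kappa^2 is left. A v whose frequencies
concentrate at that point has |g|_2 of order kappa^2 |v|_2, whereas
|i s v + omega R v|_2 = lambda |kappa| |v|_2; the quotient is of order
lambda / |kappa| and grows like n^(1/2), indeed like n, when |kappa| <= 1/n.

The field is explicit. With y = eps x, Y = y_2 + i y_3 and K = m + 1, put
  F = exp (i kappa x_1 - |y|^2),
  v = (2 eps Y^(m+1), a Y^m, i a Y^m) F,   a = i kappa - 2 eps y_1.
It is solenoidal because (d_2 + i d_3) Y^m = 0 ([div_vel]), and it is an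
eigenfield of R because Y^m has angular momentum m ([isrot_vel]). Replacing s by
omega (m+1) + lambda kappa leaves g = kappa^2 v + eps r, where each component of r
is a polynomial in y, with coefficients bounded in eps, times F
([packet_balance]). Both |eps r|_2^2 = O(eps^2 / eps^3) and
|v|_2^2 >= c / eps^3 scale with the volume, so eps r is negligible for small eps
([small_defect]), whatever m and kappa are. Hence g lies between multiples of
kappa^2 v, and in particular does not vanish ([resonant_solution]).

All functions that occur are wave packets: polynomial in y times F. They are
handled through a syntax [expr] of polynomials with a formal derivative, so the
differential identities become ring identities. A Gaussian bound, uniform in eps,
puts every packet in L^2 ([packet_bound]), and the classical derivative of a
packet is its weak derivative by Fubini's theorem and the fundamental theorem of
calculus on each line ([weak_derivative_R3]).

It remains to choose s_n. Taking omega + lambda / (n+1) proves the first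
assertion. If alpha / omega is irrational, the pigeonhole principle gives natural
numbers z and m for which alpha z - omega (m+1) is nonzero and as small as desired
([small_linear_form]); then s_n = alpha z_n. *)

Set Implicit Arguments.
Unset Strict Implicit.

(** * Continuous functions on the product are measurable *)

Section Measurability.
Context (R : realType).

(** Rounding z down to the grid of mesh 1/(n+1) makes the function piecewise
constant in z on countably many strips, hence jointly measurable, and continuity
in z gives convergence as n grows. Applied twice, this shows that test functions
are measurable for the product sigma-algebra on R^3. *)
Lemma caratheodory_measurable d (T : measurableType d)
    (h : T * measurableTypeR R -> R) :
  (forall z, measurable_fun setT (fun t => h (t, z))) ->
  (forall t, continuous (fun z : R => h (t, z))) ->
  measurable_fun setT h.
Proof.
move=> mh ch.
pose q (n : nat) (z : R) : R := (Num.floor (n.+1%:R * z))%:~R / n.+1%:R.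
have qz z : (fun n => q n z) @ \oo --> z.
  apply/cvgrPdist_le => e e0; near=> n.
  have n0 : 0 < n.+1%:R :> R by rewrite ltr0n.
  have le1 := floor_le (n.+1%:R * z).
  have lt1 := floorD1_gt (n.+1%:R * z).
  rewrite /q.
  have -> : z - (Num.floor (n.+1%:R * z))%:~R / n.+1%:R
     = (n.+1%:R * z - (Num.floor (n.+1%:R * z))%:~R) / n.+1%:R.
    by field; rewrite addrC natr1 gt_eqF.
  rewrite ger0_norm; last by apply: divr_ge0; [rewrite subr_ge0|exact: ltW].
  rewrite ler_pdivrMr//.
  have : (n.+1%:R * z - (Num.floor (n.+1%:R * z))%:~R) <= 1.
    by move: lt1; rewrite intrD; lra.
  move/le_trans; apply.
  rewrite -ler_pdivrMr// div1r ltW//.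
  near: n; exact: (near_infty_natSinv_lt (PosNum e0)).
have mq n : measurable_fun setT (fun p : T * measurableTypeR R => h (p.1, q n p.2)).
  move=> _ B mB; rewrite setTI.
  have -> : (fun p : T * measurableTypeR R => h (p.1, q n p.2)) @^-1` B =
    \bigcup_k (((fun t => h (t, k%:~R / n.+1%:R)) @^-1` B) `*`
       [set z : measurableTypeR R | Num.floor (n.+1%:R * z) = k]).
    apply/seteqP; split=> [[t z]/= Bh|[t z]/= [k _ [/= Bh kE]]]; last by rewrite /q kE.
    by exists (Num.floor (n.+1%:R * z)).
  apply: countable_bigcupT_measurable => // k; apply: measurableX.
    by rewrite -[X in measurable X]setTI; exact: mh.
  have -> : [set z : measurableTypeR R | Num.floor (n.+1%:R * z) = k] =
      `[(k%:~R / n.+1%:R : R), ((k + 1)%:~R / n.+1%:R)[%classic.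
    apply/seteqP; split=> z /=; rewrite in_itv/= ler_pdivrMr ?ltr_pdivlMr ?ltr0n//.
      move=> <-; rewrite ![z * _]mulrC; rewrite floor_le/=.
      exact: floorD1_gt.
    rewrite ![z * _]mulrC => /andP[k1 k2]; apply/eqP.
    by rewrite floor_eq// -?intrD ?k1.
  exact: measurable_itv.
apply: (measurable_fun_cvg mq) => -[t z] _ /=.
have := ch t z.
exact: (cvg_comp _ _ (qz z)).
Unshelve. all: by end_near. Qed.

Lemma continuous_pair (T U V : topologicalType) (f : T -> U) (g : T -> V) :
  continuous f -> continuous g -> continuous (fun t => (f t, g t)).
Proof.
by move=> cf cg t; exact: (@cvg_pair _ _ _ _ _ _ _ _ _ f g (cf t) (cg t)).
Qed.

Lemma continuous_measurable_R3 (f : R3 R -> R) :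
  continuous (f : R * R * R -> R) -> measurable_fun setT f.
Proof.
move=> cf.
have cfP (g : R -> R * R * R) : continuous g -> continuous (fun t => f (g t)).
  by move=> cg t; exact: (@continuous_comp _ _ _ g (f : R * R * R -> R) t (cg t) (cf _)).
have cid : continuous (id : R -> R) by move=> ?; exact: cvg_id.
have ccst (V : topologicalType) (p : V) : continuous (fun _ : R => p).
  by move=> ?; exact: cvg_cst.
apply: caratheodory_measurable => [z|p]; last first.
  have cp : continuous (fun z : R => ((p : R * R), z)).
    by apply: continuous_pair; [exact: (ccst (R * R)%type p)|exact: cid].
  exact: (cfP _ cp).
apply: caratheodory_measurable => [y|x].
  apply: continuous_measurable_fun.
  exact: (cfP (fun x => ((x, y), z))
    (continuous_pair (continuous_pair cid (ccst R y)) (ccst R z))).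
exact: (cfP (fun y => ((x, y), z))
    (continuous_pair (continuous_pair (ccst R x) cid) (ccst R z))).
Qed.

End Measurability.

(** * Lebesgue measure on R^3 as an iterated integral *)

Section ProductLebesgue.
Context (R : realType).
Local Notation mu := (@lebesgue_measure R).

(** The product measure on R^2 has a name of its own in order to carry a
sigma-finite structure, which Fubini's theorem asks of both factors of
(mu \x mu) \x mu. *)
Definition mu2 : set (measurableTypeR R * measurableTypeR R) -> \bar R :=
  (mu \x mu)%E.
HB.instance Definition _ := Measure.copy mu2 (mu \x mu)%E.

Let mu2_sigma_finite : sigma_finite setT mu2.
Proof.
have /sigma_finiteP[F [TF ndF Foo]] := sigma_finiteT mu.
exists (fun n => F n `*` F n).
  rewrite -setXTT TF predeqE => -[x y]; split.
    move=> [/= [n _ Fnx] [k _ Fky]]; exists (maxn n k) => //; split.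
    - by move: x Fnx; exact/subsetPset/ndF/leq_maxl.
    - by move: y Fky; exact/subsetPset/ndF/leq_maxr.
  by move=> [n _ []/= ? ?]; split; exists n.
move=> k; have [? ?] := Foo k.
split; first exact: measurableX.
by rewrite /mu2 product_measure1E// lte_mul_pinfty// ge0_fin_numE.
Qed.

HB.instance Definition _ := Measure_isSigmaFinite.Build _ _ _ mu2
  mu2_sigma_finite.

Lemma tonelli_R3 (f : R3 R -> \bar R) :
  measurable_fun setT f -> (forall x, (0 <= f x)%E) ->
  (\int[mu3 R]_x f x = \int[mu2]_p \int[mu]_z f (p, z))%E.
Proof.
move=> mf f0.
exact: (@fubini_tonelli1 _ _ _ _ R mu2 mu f mf f0).
Qed.

Lemma fubini_R3_last (f : R3 R -> \bar R) :
  (mu3 R).-integrable setT f ->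
  (\int[mu3 R]_x f x = \int[mu2]_p \int[mu]_z f (p, z))%E.
Proof.
move=> fi.
by rewrite (@integral12_prod_meas1 _ _ _ _ R mu2 mu f fi).
Qed.

Lemma fubini_R3_first (f : R3 R -> \bar R) :
  (mu3 R).-integrable setT f ->
  (\int[mu3 R]_x f x = \int[mu]_z \int[mu2]_p f (p, z))%E.
Proof.
move=> fi.
by rewrite (@integral21_prod_meas1 _ _ _ _ R mu2 mu f fi).
Qed.

Definition set_coord (j : 'I_3) (x : R3 R) (t : R) : R3 R :=
  ((if j == 0 then t else x.1.1, if j == 1 then t else x.1.2),
   if j == 2 then t else x.2).

Lemma ord3_ind (P : 'I_3 -> Prop) : P 0 -> P 1 -> P 2 -> forall j, P j.
Proof.
move=> P0 P1 P2 [[|[|[|//]]] i].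
- by rewrite (_ : Ordinal i = 0)//; apply: val_inj.
- by rewrite (_ : Ordinal i = 1)//; apply: val_inj.
- by rewrite (_ : Ordinal i = 2)//; apply: val_inj.
Qed.

(** The integral over R^3 can be computed with the j-th variable innermost. For
the first two variables this uses Fubini's theorem twice, the planar sections of
an integrable function being integrable almost everywhere. *)
Lemma integral_lines_eq0 (j : 'I_3) (h : R3 R -> \bar R) :
  (mu3 R).-integrable setT h ->
  (forall x, \int[mu]_t h (set_coord j x t) = 0)%E ->
  (\int[mu3 R]_x h x = 0)%E.
Proof.
move=> ih; elim/ord3_ind: j => h0.
- rewrite fubini_R3_first//.
  rewrite (ae_eq_integral (cst 0%E) _ measurableT) ?integral0//.
    exact: (@measurable_fubini_G _ _ _ _ _ mu2 mu h ih).
  apply: filterS (@ae_integrable2 _ _ _ _ _ mu2 mu h ih) => z iz _ /=.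
  rewrite -(@integral21_prod_meas1 _ _ _ _ R mu mu (fun p => h (p, z)) iz).
  by rewrite integral0_eq// => y _; exact: (h0 ((0, y), z)).
- rewrite fubini_R3_first//.
  rewrite (ae_eq_integral (cst 0%E) _ measurableT) ?integral0//.
    exact: (@measurable_fubini_G _ _ _ _ _ mu2 mu h ih).
  apply: filterS (@ae_integrable2 _ _ _ _ _ mu2 mu h ih) => z iz _ /=.
  rewrite -(@integral12_prod_meas1 _ _ _ _ R mu mu (fun p => h (p, z)) iz).
  by rewrite integral0_eq// => x _; exact: (h0 ((x, 0), z)).
- rewrite fubini_R3_last//.
  by rewrite integral0_eq// => -[x y] _; exact: (h0 ((x, y), 0)).
Qed.

End ProductLebesgue.

(** * Gaussians *)

Section Gaussian.
Context (R : realType).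
Local Notation mu := (@lebesgue_measure R).

Definition gauss1 (e : R) (t : R) : R := expR (- (e * t) ^+ 2).

Definition gauss3 (e : R) (x : R3 R) : R :=
  gauss1 e x.1.1 * gauss1 e x.1.2 * gauss1 e x.2.

Lemma measurable_gauss1 e : measurable_fun setT (gauss1 e).
Proof.
apply: measurableT_comp; first exact: measurable_expR.
apply: measurable_funN; apply: measurable_funX; exact: measurable_funM.
Qed.

Lemma gauss1_ge0 e t : 0 <= gauss1 e t. Proof. exact: expR_ge0. Qed.

Lemma integral_gauss1 e : 0 < e ->
  (\int[mu]_t (gauss1 e t)%:E = (Num.sqrt pi / e)%:E)%E.
Proof.
move=> e0; have s20 : 0 < Num.sqrt 2 :> R by rewrite sqrtr_gt0.
have s22 : Num.sqrt 2 ^+ 2 = 2 :> R by rewrite sqr_sqrtr.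
pose s : R := (e * Num.sqrt 2)^-1.
have s0 : s != 0 by rewrite invr_eq0 mulf_neq0 ?gt_eqF.
(* gauss1 e is a normal density of variance 1 / (2 e^2), up to its peak value. *)
have pk : normal_peak s = e / Num.sqrt pi.
  rewrite /normal_peak -mulr_natr.
  have -> : s ^+ 2 * pi * 2 = pi / e ^+ 2.
    rewrite /s exprVn exprMn s22; field.
    by rewrite gt_eqF.
  by rewrite sqrtrM ?pi_ge0// sqrtrV ?sqr_ge0// sqrtr_sqr gtr0_norm// invfM invrK mulrC.
have E : (fun t => (gauss1 e t)%:E) =
    (fun t => (Num.sqrt pi / e)%:E * (normal_pdf 0 s t)%:E)%E.
  apply/funext => t; rewrite -EFinM normal_pdfE// pk /normal_fun /gauss1.
  rewrite mulrA.
  have sp0 : Num.sqrt pi != 0 :> R by rewrite gt_eqF// sqrtr_gt0 pi_gt0.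
  have -> : Num.sqrt pi / e * (e / Num.sqrt pi) = 1 :> R.
    by field; rewrite sp0 gt_eqF.
  rewrite mul1r; congr ((expR _)%:E).
  rewrite /s subr0 -mulr_natr exprVn [(e * Num.sqrt 2) ^+ 2]exprMn s22.
  by field; rewrite gt_eqF.
rewrite E ge0_integralZl//=.
- by rewrite integral_normal_pdf mule1.
- by apply/measurable_EFinP; exact: measurable_normal_pdf.
- by move=> t _; rewrite lee_fin normal_pdf_ge0.
- by rewrite lee_fin divr_ge0 ?sqrtr_ge0 ?ltW.
Qed.

Lemma measurable_gauss2 e : measurable_fun setT
  (fun p : measurableTypeR R * measurableTypeR R => gauss1 e p.1 * gauss1 e p.2).
Proof.
apply: measurable_funM.
  apply: (@measurableT_comp _ _ _ _ _ _ (gauss1 e) _ fst) => //.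
  exact: measurable_gauss1.
apply: (@measurableT_comp _ _ _ _ _ _ (gauss1 e) _ snd) => //.
exact: measurable_gauss1.
Qed.

Lemma integral_gauss2 e : 0 < e ->
  (\int[mu \x mu]_p (gauss1 e p.1 * gauss1 e p.2)%:E
    = ((Num.sqrt pi / e) ^+ 2)%:E)%E.
Proof.
move=> e0; rewrite fubini_tonelli1//=; first last.
- by move=> p; rewrite lee_fin mulr_ge0 ?gauss1_ge0.
- by apply/measurable_EFinP; exact: measurable_gauss2.
transitivity (\int[mu]_x ((Num.sqrt pi / e)%:E * (gauss1 e x)%:E))%E.
  apply: eq_integral => x _; rewrite /fubini_F/=.
  under eq_integral do rewrite EFinM.
  rewrite ge0_integralZl//=.
  - by rewrite integral_gauss1// muleC.
  - by apply/measurable_EFinP; exact: measurable_gauss1.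
  - by move=> t _; rewrite lee_fin gauss1_ge0.
  - by rewrite lee_fin gauss1_ge0.
rewrite ge0_integralZl//=.
- by rewrite integral_gauss1// -EFinM expr2.
- by apply/measurable_EFinP; exact: measurable_gauss1.
- by move=> t _; rewrite lee_fin gauss1_ge0.
- by rewrite lee_fin divr_ge0 ?sqrtr_ge0 ?ltW.
Qed.

Lemma gauss3_ge0 e x : 0 <= gauss3 e x.
Proof. by rewrite !mulr_ge0 ?gauss1_ge0. Qed.

Lemma measurable_gauss3 e : measurable_fun setT (gauss3 e).
Proof.
apply: measurable_funM.
  exact: (@measurableT_comp _ _ _ _ _ _ _ _ fst (measurable_gauss2 e)).
apply: (@measurableT_comp _ _ _ _ _ _ (gauss1 e) _ snd) => //.
exact: measurable_gauss1.
Qed.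

Lemma integral_gauss3 e : 0 < e ->
  (\int[mu3 R]_x (gauss3 e x)%:E = ((Num.sqrt pi / e) ^+ 3)%:E)%E.
Proof.
move=> e0; rewrite tonelli_R3; first last.
- by move=> p; rewrite lee_fin gauss3_ge0.
- by apply/measurable_EFinP; exact: measurable_gauss3.
transitivity (\int[mu \x mu]_p ((Num.sqrt pi / e)%:E *
    (gauss1 e p.1 * gauss1 e p.2)%:E))%E.
  apply: eq_integral => x _; rewrite /gauss3/=.
  under eq_integral do rewrite EFinM.
  rewrite ge0_integralZl//=.
  - by rewrite integral_gauss1// muleC.
  - by apply/measurable_EFinP; exact: measurable_gauss1.
  - by move=> t _; rewrite lee_fin gauss1_ge0.
  - by rewrite lee_fin mulr_ge0 ?gauss1_ge0.
rewrite ge0_integralZl//=.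
- by rewrite integral_gauss2// -EFinM -exprS.
- by apply/measurable_EFinP; exact: measurable_gauss2.
- by move=> t _; rewrite lee_fin mulr_ge0 ?gauss1_ge0.
- by rewrite lee_fin divr_ge0 ?sqrtr_ge0 ?ltW.
Qed.

Lemma integrable_gauss3 e : 0 < e -> (mu3 R).-integrable setT (EFin \o gauss3 e).
Proof.
move=> e0; apply/integrableP; split.
  by apply/measurable_EFinP; exact: measurable_gauss3.
under eq_integral do rewrite gee0_abs ?lee_fin ?gauss3_ge0//.
by rewrite integral_gauss3// ltry.
Qed.

Lemma integrable_gauss3_dom e K (f : R3 R -> R) : 0 < e ->
  measurable_fun setT f -> (forall x, `|f x| <= K * gauss3 e x) ->
  (mu3 R).-integrable setT (EFin \o f).
Proof.
move=> e0 mf fK.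
apply: (@le_integrable _ _ _ _ _ measurableT _ (fun x => K%:E * (gauss3 e x)%:E)%E).
- exact/measurable_EFinP.
- by move=> x _; rewrite /= lee_fin (le_trans (fK x))// ler_norm.
- exact: (integrableZl measurableT K (integrable_gauss3 e0)).
Qed.

End Gaussian.

(** * Integration by parts against test functions *)

Section LineDerivatives.
Context (R : realType).
Local Notation mu := (@lebesgue_measure R).

Lemma integral_derive_eq0 (H H' : R -> R) (N : R) :
  (forall t : R, is_derive t 1 H (H' t)) -> continuous H' ->
  (forall t, N < `|t| -> H t = 0 /\ H' t = 0) ->
  (\int[mu]_t (H' t)%:E = 0)%E.
Proof.
move=> dH cH' H0.
pose M : R := `|N| + 1.
have NM : N < M by rewrite /M; have := ler_norm N; lra.
have M0 : 0 < M by rewrite ltr_wpDl.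
have cH : continuous H.
  move=> t; apply/differentiable_continuous/derivable1_diffP.
  by have [] := dH t.
have -> : (\int[mu]_t (H' t)%:E = \int[mu]_(t in `[(- M)%R, M]) (H' t)%:E)%E.
  rewrite [RHS]integral_mkcond; apply: eq_integral => t _.
  rewrite patchE; case: ifPn => // /negP tM; congr EFin.
  apply: (H0 t _).2; apply: (lt_trans NM); rewrite ltNge; apply/negP => tM'.
  by apply: tM; rewrite inE/= in_itv/= -ler_norml.
rewrite (@continuous_FTC2 R H' H).
- have HM : H M = 0 by apply: (H0 _ _).1; rewrite gtr0_norm.
  have HN : H (- M) = 0 by apply: (H0 _ _).1; rewrite normrN gtr0_norm.
  by rewrite HM HN subee.
- by rewrite (lt_trans _ M0)// oppr_lt0.
- exact: continuous_subspaceT.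
- split.
  + by move=> t _; have [] := dH t.
  + exact/cvg_at_right_filter/cH.
  + exact/cvg_at_left_filter/cH.
- by move=> t _; have [] := dH t; rewrite derive1E.
Qed.

(** The derivative of f along the lines parallel to the j-th axis. Fubini's
theorem leaves integrals over such lines, so one-variable calculus suffices. *)
Variant line_derive (j : 'I_3) (f f' : R3 R -> R) : Prop := LineDerive of
  forall x (t : R), is_derive t 1 (fun s => f (set_coord j x s)) (f' (set_coord j x t)).

Lemma line_deriveP j f f' : line_derive j f f' ->
  forall x (t : R), is_derive t 1 (fun s => f (set_coord j x s)) (f' (set_coord j x t)).
Proof. by case. Qed.

Lemma line_derive_pd j (phi : R3 R -> R) :
  (forall x, differentiable (phi : R * R * R -> R) x) ->
  line_derive j phi (pd j phi).
Proof.
move=> dphi; split=> x t.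
have E h : set_coord j x (h *: 1 + t) = h *: basis3 R j + set_coord j x t.
  rewrite /set_coord /basis3 /GRing.scale/= /GRing.scale/=.
  have E0 (a : R) : a = h * 0 + a by rewrite mulr0 add0r.
  by elim/ord3_ind: j => /=; congr (_, _, _); exact: E0.
have D := diff_derivable (v := basis3 R j) (dphi (set_coord j x t)).
have F : (fun h => h^-1 *: ((phi (set_coord j x (h *: 1 + t))) - phi (set_coord j x t))) =
  (fun h => h^-1 *: ((phi (h *: basis3 R j + set_coord j x t)) - phi (set_coord j x t))).
  by apply/funext => h; rewrite E.
apply: DeriveDef.
  by rewrite /derivable; move: D; rewrite /derivable -F.
by rewrite /pd /derive -F.
Qed.

Lemma line_derive_continuous j f f' : line_derive j f f' ->
  forall x, continuous (fun t : R => f (set_coord j x t)).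
Proof.
move=> df x t; apply/differentiable_continuous/derivable1_diffP.
by have [] := line_deriveP df x t.
Qed.

(** Outside the closed support, which is compact, phi vanishes on a neighbourhood,
so the derivative vanishes there as well; on the support both are continuous. *)
Lemma test_fun_bounded (phi : R3 R -> R) (j : 'I_3) : test_fun phi ->
  exists M N : R, forall x,
    [/\ `|phi x| <= M, `|pd j phi x| <= M &
        forall k, N < `|coords x 0 k| -> phi x = 0 /\ pd j phi x = 0].
Proof.
move=> [dphi cK]; set K := closure _ in cK.
have dphi0 := dphi [::]; have dphi1 := dphi [:: j]; rewrite /= in dphi0 dphi1.
have phi0 x : ~ K x -> phi x = 0.
  move=> Kx; apply: contrapT => /eqP px; apply: Kx; exact: subset_closure.
have oK : open (~` K : set (R * R * R)).
  by rewrite openC; exact: closed_closure.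
have pd0 x : ~ K x -> pd j phi x = 0.
  move=> Kx; rewrite /pd.
  rewrite (@near_eq_derive _ _ _ _ (cst 0) x (basis3 R j)) ?derive_cst//.
  have := open_nbhs_nbhs (conj oK Kx); apply: filterS => y /= Ky.
  exact: phi0.
have bnd (f : R * R * R -> R) : (forall x, {for x, continuous f}) ->
    (forall x, ~ K x -> f x = 0) -> exists M, forall x, `|f x| <= M.
  move=> cf f0.
  have : compact (f @` K).
    apply: continuous_compact => //; apply: continuous_subspaceT; exact: cf.
  move/compact_bounded => [M [_ HM]].
  exists (`|M| + 1) => x; have [Kx|Kx] := pselect (K x).
    apply: (HM (`|M| + 1)); last by exists x.
    by rewrite (le_lt_trans (ler_norm M))// ltrDl.
  by rewrite f0// normr0 addr_ge0.
have [M1 H1] := bnd phi (fun x => differentiable_continuous (dphi0 x)) phi0.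
have [M2 H2] := bnd (pd j phi) (fun x => differentiable_continuous (dphi1 x)) pd0.
have /compact_bounded[N [_ HN]] := cK.
exists (Num.max M1 M2), (`|N| + 1) => x; split.
- by rewrite le_max H1.
- by rewrite le_max H2 orbT.
- move=> k Nk.
  have Kx : ~ K x.
    move=> Kx; move: Nk; apply/negP; rewrite -leNgt.
    have := HN (`|N| + 1) _ x Kx.
    rewrite (le_lt_trans (ler_norm N)) ?ltrDl// => /(_ isT) /=.
    apply: le_trans.
    rewrite mxE; elim/ord3_ind: k => /=; rewrite /Num.norm/= !le_max lexx ?orbT//.
  by split; [exact: phi0|exact: pd0].
Qed.

End LineDerivatives.

Section WeakDerivatives.
Context (R : realType).
Local Notation C := R[i].

(** The sum f phi_j + f' phi is the derivative of f phi along the lines parallel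
to the j-th axis, and f phi has compact support on each of them. The Gaussian
bound makes the two products integrable. *)
Lemma weak_derivative_R3 j (f f' : R3 R -> R) e K phi : 0 < e ->
  measurable_fun setT f -> measurable_fun setT f' ->
  (forall x, `|f x| <= K * gauss3 e x) ->
  (forall x, `|f' x| <= K * gauss3 e x) ->
  line_derive j f f' ->
  (forall x, continuous (fun t : R => f' (set_coord j x t))) ->
  test_fun phi ->
  \int[mu3 R]_x (f x * pd j phi x) = - \int[mu3 R]_x (f' x * phi x).
Proof.
move=> e0 mf mf' fK f'K df cf' tphi.
have [M [N HMN]] := test_fun_bounded j tphi.
have [dphi _] := tphi.
have dphi0 := dphi [::]; have dphi1 := dphi [:: j]; rewrite /= in dphi0 dphi1.
have mphi : measurable_fun setT phi.
  apply: continuous_measurable_R3 => x.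
  exact: (differentiable_continuous (dphi0 x)).
have mpd : measurable_fun setT (pd j phi).
  apply: continuous_measurable_R3 => x.
  exact: (differentiable_continuous (dphi1 x)).
have M0 : 0 <= M by have [H _ _] := HMN (0, 0, 0); exact: le_trans H.
have dom (a b : R3 R -> R) : measurable_fun setT a -> measurable_fun setT b ->
    (forall x, `|a x| <= K * gauss3 e x) -> (forall x, `|b x| <= M) ->
    (mu3 R).-integrable setT (EFin \o (fun x => a x * b x)).
  move=> ma mb aK bM.
  apply: (@integrable_gauss3_dom _ e (K * M)) => //.
    exact: measurable_funM.
  move=> x; rewrite normrM mulrAC.
  by apply: ler_pM => //; exact: normr_ge0.
have i1 : (mu3 R).-integrable setT (EFin \o (fun x => f x * pd j phi x)).
  by apply: dom => // x; have [] := HMN x.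
have i2 : (mu3 R).-integrable setT (EFin \o (fun x => f' x * phi x)).
  by apply: dom => // x; have [] := HMN x.
apply/eqP; rewrite -subr_eq0 opprK -RintegralD//.
rewrite /Rintegral (@integral_lines_eq0 _ j)//.
  exact: (integrableD measurableT i1 i2).
move=> x; pose crd t := set_coord j x t.
have crdj t : coords (set_coord j x t) 0 j = t.
  by rewrite mxE; elim/ord3_ind: j {HMN mpd dom i1 i2 dphi1 df cf' crd}.
apply: (@integral_derive_eq0 _ (fun t => f (crd t) * phi (crd t)) _ N).
- move=> t.
  have H := is_deriveM (line_deriveP df x t) (line_deriveP (line_derive_pd j dphi0) x t).
  apply: (is_derive_eq H).
  by rewrite /GRing.scale/= [phi _ * _]mulrC.
- have cphi := @line_derive_continuous _ _ _ _ (line_derive_pd j dphi0) x.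
  have cpd := @line_derive_continuous _ _ _ _ (line_derive_pd j dphi1) x.
  have cf := @line_derive_continuous _ _ _ _ df x.
  move=> t; apply: cvgD; apply: cvgM; [exact: cf|exact: cpd|exact: cf'|exact: cphi].
- move=> t Nt; have [_ _ /(_ j)] := HMN (crd t).
  by rewrite crdj => /(_ Nt) [-> ->]; rewrite !mulr0 addr0.
Qed.

Definition cline_derive (j : 'I_3) (u u' : R3 R -> C) :=
  line_derive j (fun x => complex.Re (u x)) (fun x => complex.Re (u' x)) /\
  line_derive j (fun x => complex.Im (u x)) (fun x => complex.Im (u' x)).

Lemma cabs2E (z : C) : cabs z ^+ 2 = complex.Re z ^+ 2 + complex.Im z ^+ 2.
Proof.
by case: z => a b; rewrite /cabs /= sqr_sqrtr// addr_ge0// sqr_ge0.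
Qed.

Lemma cabs_ge0 (z : C) : 0 <= cabs z.
Proof. by case: z => a b; rewrite /cabs /= sqrtr_ge0. Qed.

Lemma normRe_le (z : C) : `|complex.Re z| <= cabs z.
Proof.
rewrite -ler_sqr ?nnegrE ?normr_ge0 ?cabs_ge0//.
by rewrite cabs2E real_normK ?num_real// lerDl sqr_ge0.
Qed.

Lemma normIm_le (z : C) : `|complex.Im z| <= cabs z.
Proof.
rewrite -ler_sqr ?nnegrE ?normr_ge0 ?cabs_ge0//.
by rewrite cabs2E real_normK ?num_real// lerDr sqr_ge0.
Qed.

(** The derivative u'' makes u' continuous on lines, as the fundamental theorem of
calculus requires. *)
Lemma weak_pd_line_derive j (u u' u'' : R3 R -> C) e K : 0 < e ->
  cmeasurable u -> cmeasurable u' ->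
  (forall x, cabs (u x) <= K * gauss3 e x) ->
  (forall x, cabs (u' x) <= K * gauss3 e x) ->
  cline_derive j u u' -> cline_derive j u' u'' -> weak_pd j u u'.
Proof.
move=> e0 [mRu mIu] [mRu' mIu'] uK u'K [dR dI] [dR' dI'] phi tphi.
have reM (z : C) (r : R) : complex.Re (z * r%:C%C) = complex.Re z * r.
  by case: z => a b /=; rewrite mulr0 subr0.
have imM (z : C) (r : R) : complex.Im (z * r%:C%C) = complex.Im z * r.
  by case: z => a b /=; rewrite mulr0 add0r.
rewrite /cintegral.
under [in LHS]eq_Rintegral do rewrite reM.
under [X in (_ +i* X)%C = _]eq_Rintegral do rewrite imM.
under [in RHS]eq_Rintegral do rewrite reM.
under [X in _ = - (_ +i* X)%C]eq_Rintegral do rewrite imM.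
rewrite (@weak_derivative_R3 j _ (fun x => complex.Re (u' x)) e K)//.
- rewrite (@weak_derivative_R3 j _ (fun x => complex.Im (u' x)) e K)//.
  + by move=> x; exact: le_trans (normIm_le _) (uK x).
  + by move=> x; exact: le_trans (normIm_le _) (u'K x).
  + exact: (@line_derive_continuous _ _ _ _ dI').
- by move=> x; exact: le_trans (normRe_le _) (uK x).
- by move=> x; exact: le_trans (normRe_le _) (u'K x).
- exact: (@line_derive_continuous _ _ _ _ dR').
Qed.

End WeakDerivatives.

(** * Wave packets and their formal derivatives *)

Section WavePackets.
Context (R : realType).
Local Notation C := R[i].
Local Open Scope complex_scope.

Lemma line_derive_eq j (f f' g' : R3 R -> R) :
  line_derive j f f' -> f' =1 g' -> line_derive j f g'.
Proof. by move=> df fg; split=> x t; rewrite -fg; exact: line_deriveP. Qed.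

Lemma line_derive_cst j (c : R) : line_derive j (fun=> c) (fun=> 0).
Proof. by split=> x t; exact: is_derive_cst. Qed.

Lemma line_deriveD j (f f' g g' : R3 R -> R) :
  line_derive j f f' -> line_derive j g g' ->
  line_derive j (fun x => f x + g x) (fun x => f' x + g' x).
Proof.
move=> df dg; split=> x t.
exact: (is_deriveD (line_deriveP df x t) (line_deriveP dg x t)).
Qed.

Lemma line_deriveN j (f f' : R3 R -> R) :
  line_derive j f f' -> line_derive j (fun x => - f x) (fun x => - f' x).
Proof. by move=> df; split=> x t; exact: (is_deriveN (line_deriveP df x t)). Qed.

Lemma line_deriveM j (f f' g g' : R3 R -> R) :
  line_derive j f f' -> line_derive j g g' ->
  line_derive j (fun x => f x * g x) (fun x => f' x * g x + f x * g' x).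
Proof.
move=> df dg; split=> x t.
apply: (is_derive_eq (is_deriveM (line_deriveP df x t) (line_deriveP dg x t))).
by rewrite /GRing.scale/= addrC [g _ * _]mulrC.
Qed.

Lemma line_derive_coord j k (g g' : R -> R) :
  (forall t : R, is_derive t 1 g (g' t)) ->
  line_derive j (fun x => g (coords x 0 k))
    (fun x => (k == j)%:R * g' (coords x 0 k)).
Proof.
move=> dg; split=> x t; have [->|kj] := eqVneq k j.
  have E s : coords (set_coord j x s) 0 j = s by rewrite mxE; elim/ord3_ind: j.
  rewrite E mul1r; under eq_fun do rewrite E; exact: dg.
have E s : coords (set_coord j x s) 0 k = coords x 0 k.
  by rewrite !mxE; move: kj; elim/ord3_ind: j; elim/ord3_ind: k.
rewrite mul0r; under eq_fun do rewrite E; exact: is_derive_cst.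
Qed.

Lemma cline_derive_eq j (u u' w' : R3 R -> C) :
  cline_derive j u u' -> u' =1 w' -> cline_derive j u w'.
Proof. by move=> du /funext <-. Qed.

Lemma cline_derive_cst j (c : C) : cline_derive j (fun=> c) (fun=> 0).
Proof. by split; exact: line_derive_cst. Qed.

Lemma cline_derive_real j (f f' : R3 R -> R) : line_derive j f f' ->
  cline_derive j (fun x => (f x)%:C) (fun x => (f' x)%:C).
Proof. by move=> df; split=> //; exact: line_derive_cst. Qed.

Lemma Re_addc (z w : C) : complex.Re (z + w) = complex.Re z + complex.Re w.
Proof. by case: z w => [a b] [c d]. Qed.

Lemma Im_addc (z w : C) : complex.Im (z + w) = complex.Im z + complex.Im w.
Proof. by case: z w => [a b] [c d]. Qed.

Lemma Re_mulc (z w : C) :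
  complex.Re (z * w) = complex.Re z * complex.Re w - complex.Im z * complex.Im w.
Proof. by case: z w => [a b] [c d]. Qed.

Lemma Im_mulc (z w : C) :
  complex.Im (z * w) = complex.Re z * complex.Im w + complex.Im z * complex.Re w.
Proof. by case: z w => [a b] [c d]. Qed.

Lemma cline_deriveD j (u u' w w' : R3 R -> C) :
  cline_derive j u u' -> cline_derive j w w' ->
  cline_derive j (fun x => u x + w x) (fun x => u' x + w' x).
Proof.
move=> [Ru Iu] [Rw Iw]; rewrite /cline_derive; split.
  under eq_fun do rewrite Re_addc.
  by apply: (line_derive_eq (line_deriveD Ru Rw)) => x; rewrite Re_addc.
under eq_fun do rewrite Im_addc.
by apply: (line_derive_eq (line_deriveD Iu Iw)) => x; rewrite Im_addc.
Qed.

Lemma cline_deriveM j (u u' w w' : R3 R -> C) :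
  cline_derive j u u' -> cline_derive j w w' ->
  cline_derive j (fun x => u x * w x) (fun x => u' x * w x + u x * w' x).
Proof.
move=> [Ru Iu] [Rw Iw]; rewrite /cline_derive; split.
  under eq_fun do rewrite Re_mulc.
  apply: (line_derive_eq
    (line_deriveD (line_deriveM Ru Rw) (line_deriveN (line_deriveM Iu Iw)))) => x.
  by rewrite Re_addc !Re_mulc; ring.
under eq_fun do rewrite Im_mulc.
apply: (line_derive_eq (line_deriveD (line_deriveM Ru Iw) (line_deriveM Iu Rw))) => x.
by rewrite Im_addc !Im_mulc; ring.
Qed.

(** Polynomials in the scaled variables y_j = eps x_j and in eps. The parameter
eps is a symbol of its own so that bounds on the values hold uniformly in eps. *)
Inductive expr := Cst of C | Eps | Var of 'I_3 | Add of expr & expr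
  | Mul of expr & expr.

Fixpoint eval_expr (e : R) (x : R3 R) (p : expr) : C :=
  match p with
  | Cst c => c
  | Eps => e%:C
  | Var j => (e * coords x 0 j)%:C
  | Add p q => eval_expr e x p + eval_expr e x q
  | Mul p q => eval_expr e x p * eval_expr e x q
  end.

Fixpoint deriv_expr (j : 'I_3) (p : expr) : expr :=
  match p with
  | Cst _ | Eps => Cst 0
  | Var k => Cst (k == j)%:R
  | Add p q => Add (deriv_expr j p) (deriv_expr j q)
  | Mul p q => Add (Mul (deriv_expr j p) q) (Mul p (deriv_expr j q))
  end.

Lemma cline_derive_eval_expr e j p :
  cline_derive j (fun x => eval_expr e x p)
    (fun x => e%:C * eval_expr e x (deriv_expr j p)).
Proof.
elim: p => [c||k|p IHp q IHq|p IHp q IHq] /=.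
- by rewrite mulr0; exact: cline_derive_cst.
- by rewrite mulr0; exact: cline_derive_cst.
- have H : line_derive j (fun x => e * coords x 0 k) (fun x => (k == j)%:R * e).
    apply: (@line_derive_coord j k (fun t => e * t) (fun=> e)) => t.
    apply: (is_derive_eq (is_deriveZ e (is_derive_id t (1 : R)))).
    by rewrite /GRing.scale/= mulr1.
  apply: (cline_derive_eq (cline_derive_real H)) => x.
  by case: (k == j); rewrite ?mul1r ?mulr1 ?mul0r ?mulr0.
- by apply: (cline_derive_eq (cline_deriveD IHp IHq)) => x; rewrite mulrDr.
- by apply: (cline_derive_eq (cline_deriveM IHp IHq)) => x /=; ring.
Qed.

Definition phase (k : R) (x : R3 R) : C := cos (k * x.1.1) +i* sin (k * x.1.1).

(** p (eps, eps x) exp (i k x_1 - |eps x|^2). *)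
Definition packet (e k : R) (p : expr) (x : R3 R) : C :=
  eval_expr e x p * ((gauss3 e x)%:C * phase k x).

(** Conjugation of d/dy_j by the Gaussian exp (- |y|^2): this acts on the
polynomial factor of a packet as d/dy_j acts on its product with the Gaussian. *)
Definition deriv_gauss (j : 'I_3) (p : expr) : expr :=
  Add (deriv_expr j p) (Mul (Cst (- 2)) (Mul (Var j) p)).

(** The polynomial factor of d_j of a packet. The chain rule for y = eps x gives
the factor eps, and the phase exp (i k x_1) contributes when j is the first axis. *)
Definition deriv_packet (k : R) (j : 'I_3) (p : expr) : expr :=
  Add (Mul Eps (deriv_gauss j p)) (Mul (Cst ((j == 0)%:R * (0 +i* k))) p).

Lemma is_derive_gauss1 (e t : R) :
  is_derive t 1 (gauss1 e) (- 2 * e * (e * t) * gauss1 e t).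
Proof.
rewrite /gauss1.
have H1 : is_derive t 1 (fun t : R => e * t) e.
  apply: (is_derive_eq (is_deriveZ e (is_derive_id t (1 : R)))).
  by rewrite /GRing.scale/= mulr1.
have H2 := is_deriveN (is_deriveM H1 H1).
have := is_derive1_comp (is_derive_expR _) H2.
move=> /is_derive_eq; apply.
by rewrite /GRing.scale/=; rewrite expr2 !fctE; ring.
Qed.

Lemma gauss3_coords e (x : R3 R) : gauss3 e x =
  gauss1 e (coords x 0 0) * gauss1 e (coords x 0 1) * gauss1 e (coords x 0 2).
Proof. by rewrite !mxE. Qed.

Lemma line_derive_gauss3 e j :
  line_derive j (gauss3 e) (fun x : R3 R => - 2 * e * (e * coords x 0 j) * gauss3 e x).
Proof.
have H k := line_derive_coord j k (is_derive_gauss1 e).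
have -> : gauss3 e = fun x : R3 R => gauss1 e (coords x 0 0) * gauss1 e (coords x 0 1)
   * gauss1 e (coords x 0 2) by apply/funext => x; exact: gauss3_coords.
apply: (line_derive_eq (line_deriveM (line_deriveM (H 0) (H 1)) (H 2))) => x.
by elim/ord3_ind: j {H} => /=; ring.
Qed.

Lemma cline_derive_phase k j :
  cline_derive j (phase k) (fun x : R3 R => (j == 0)%:R * (0 +i* k) * phase k x).
Proof.
have Hl t : is_derive (t : R) (1 : R) (fun t : R => k * t) k.
  apply: (is_derive_eq (is_deriveZ k (is_derive_id t (1 : R)))).
  by rewrite /GRing.scale/= mulr1.
have Hc (t : R) : is_derive t 1 (fun t : R => cos (k * t)) (- sin (k * t) * k).
  exact: (is_derive1_comp (is_derive_cos _) (Hl t)).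
have Hs (t : R) : is_derive t 1 (fun t : R => sin (k * t)) (cos (k * t) * k).
  exact: (is_derive1_comp (is_derive_sin _) (Hl t)).
have E (x : R3 R) : x.1.1 = coords x 0 0 :> R by rewrite mxE.
rewrite /phase /cline_derive/=; under eq_fun do rewrite E.
split; [apply: (line_derive_eq (line_derive_coord j 0 Hc)) |
  under eq_fun do rewrite E;
  apply: (line_derive_eq (line_derive_coord j 0 Hs))] => x;
 rewrite E; elim/ord3_ind: j => //=; ring.
Qed.

Lemma cline_derive_packet e k j p :
  cline_derive j (packet e k p) (packet e k (deriv_packet k j p)).
Proof.
have H1 := cline_derive_eval_expr e j p.
have H2 := cline_derive_real (line_derive_gauss3 e j).
have H3 := cline_derive_phase k j.
apply: (cline_derive_eq (cline_deriveM H1 (cline_deriveM H2 H3))) => x.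
rewrite /packet /deriv_packet /deriv_gauss /=.
by rewrite !rmorphM/= rmorphN rmorph_nat /=; ring.
Qed.

End WavePackets.

(** * Gaussian bounds and Sobolev regularity of packets *)

Section PacketBounds.
Context (R : realType).
Local Notation C := R[i].
Local Open Scope complex_scope.

(* cabs is a square root of a sum of squares, which simplification would expose. *)
Local Arguments cabs : simpl never.

Lemma cabsM (z w : C) : cabs (z * w) = cabs z * cabs w.
Proof. exact: ComplexField.Normc.normcM. Qed.

Lemma cabsD (z w : C) : cabs (z + w) <= cabs z + cabs w.
Proof. exact: complex.le_normcD. Qed.

Lemma cabs_real (a : R) : cabs a%:C = `|a|.
Proof. by rewrite /cabs/= expr0n addr0 sqrtr_sqr. Qed.

Lemma cabs_phase k (x : R3 R) : cabs (phase k x) = 1.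
Proof. by rewrite /cabs /phase /= cos2Dsin2 sqrtr1. Qed.

Definition sqnorm (e : R) (x : R3 R) : R :=
  (e * x.1.1) ^+ 2 + (e * x.1.2) ^+ 2 + (e * x.2) ^+ 2.

Lemma gauss3E e x : gauss3 e x = expR (- sqnorm e x).
Proof. by rewrite /gauss3 /gauss1 /sqnorm !opprD !expRD. Qed.

Lemma sqnorm_ge0 e x : 0 <= sqnorm e x.
Proof. by rewrite !addr_ge0 ?sqr_ge0. Qed.

Lemma gauss3_le1 (e : R) x : gauss3 e x <= 1.
Proof. by rewrite gauss3E -[leRHS]expR0 ler_expR oppr_le0 sqnorm_ge0. Qed.

Lemma sqr_gauss3_dom (e : R) x (K b : R) : 0 <= b -> b <= K * gauss3 e x ->
  b ^+ 2 <= K ^+ 2 * gauss3 e x.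
Proof.
move=> b0 bK; apply: (@le_trans _ _ ((K * gauss3 e x) ^+ 2)).
  by rewrite lerXn2r ?nnegrE// (le_trans b0).
by rewrite exprMn ler_wpM2l ?sqr_ge0// expr2 ler_piMl ?gauss3_ge0 ?gauss3_le1.
Qed.

Lemma eval_expr_growth (p : expr R) : exists K m, 0 <= K /\
  forall (e : R) x, 0 <= e <= 1 -> cabs (eval_expr e x p) <= K * (1 + sqnorm e x) ^+ m.
Proof.
have s1 e x : 1 <= 1 + sqnorm e x by rewrite lerDl sqnorm_ge0.
elim: p => [c||k|p [K [m [K0 IHp]]] q [L [n [L0 IHq]]]
  |p [K [m [K0 IHp]]] q [L [n [L0 IHq]]]] /=.
- by exists (cabs c), 0%N; split; [exact: cabs_ge0|move=> e x _; rewrite expr0 mulr1].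
- exists 1, 0%N; split=> // e x /andP[e0 e1].
  by rewrite expr0 mulr1 cabs_real ger0_norm.
- exists 1, 1%N; split=> // e x _; rewrite mul1r expr1 cabs_real.
  set y := e * _.
  have ysq : y ^+ 2 <= sqnorm e x.
    by rewrite /y /sqnorm mxE; elim/ord3_ind: k {y} => /=;
       rewrite -?addrA ?lerDl ?addr_ge0 ?sqr_ge0// addrCA ?lerDl ?addr_ge0 ?sqr_ge0//
         addrA lerDr addr_ge0 ?sqr_ge0.
  have : `|y| <= 1 + y ^+ 2.
    rewrite -[y ^+ 2]real_normK ?num_real//.
    by have := sqr_ge0 (`|y| - 1); have := normr_ge0 y; nra.
  by move/le_trans; apply; rewrite lerD2l.
- exists (K + L), (m + n)%N; split=> [|e x ee]; first exact: addr_ge0.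
  apply: (le_trans (cabsD _ _)); rewrite mulrDl; apply: lerD.
    apply: (le_trans (IHp _ _ ee)); apply: ler_wpM2l => //.
    by apply: ler_weXn2l => //; exact: leq_addr.
  apply: (le_trans (IHq _ _ ee)); apply: ler_wpM2l => //.
  by apply: ler_weXn2l => //; exact: leq_addl.
- exists (K * L), (m + n)%N; split=> [|e x ee]; first exact: mulr_ge0.
  rewrite cabsM exprD mulrACA; apply: ler_pM; rewrite ?cabs_ge0//.
    exact: IHp.
  exact: IHq.
Qed.

(** From 1 + t <= exp t with t = (1 + r) / c: the m-th power of the exponential
stays below exp ((1 + r) / 2) when c = 2 (m + 1). *)
Lemma pow_le_expR m : exists2 K : R, 0 <= K &
  forall r : R, 0 <= r -> (1 + r) ^+ m <= K * expR (r / 2).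
Proof.
pose c : R := 2 * m.+1%:R.
have c0 : 0 < c by rewrite mulr_gt0.
exists (c ^+ m * expR (2^-1)) => [|r r0].
  by rewrite mulr_ge0 ?expR_ge0// exprn_ge0 ?ltW.
have H : 1 + r <= c * expR ((1 + r) / c).
  rewrite -ler_pdivrMl// mulrC.
  by have := @expR_ge1Dx R ((1 + r) / c); lra.
have := lerXn2r m _ _ H.
rewrite !nnegrE => /(_ _ _)/le_trans; apply.
- by lra.
- by rewrite mulr_ge0 ?expR_ge0 ?ltW.
have c1 := ltW c0; rewrite exprMn -mulrA ler_wpM2l ?exprn_ge0//.
rewrite -expRD -expRM_natl ler_expR mulrA.
rewrite ler_pdivrMr// /c -[m.+1%:R]natr1.
rewrite (_ : (2^-1 + r / 2) * (2 * (m%:R + 1)) = (1 + r) * (m%:R + 1)); last by field.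
by rewrite mulrC ler_wpM2l// ?lerDl; lra.
Qed.

(** A polynomial factor costs part of the Gaussian decay, which leaves the wider
Gaussian of parameter e / 2. The constant K does not depend on e; the comparison
of [small_defect] rests on this. *)
Lemma packet_bound (p : expr R) k : exists2 K, 0 <= K &
  forall (e : R) x, 0 < e <= 1 -> cabs (packet e k p x) <= K * gauss3 (e / 2) x.
Proof.
have [K [m [K0 HK]]] := eval_expr_growth p.
have [L L0 HL] := pow_le_expR m.
exists (K * L) => [|e x /andP[e0 e1]]; first exact: mulr_ge0.
rewrite /packet !cabsM cabs_phase mulr1 cabs_real ger0_norm ?gauss3_ge0//.
have sq : sqnorm (e / 2) x = sqnorm e x / 4 by rewrite /sqnorm; field.
rewrite !gauss3E sq.
have e01 : 0 <= e <= 1 by rewrite ltW.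
apply: (@le_trans _ _ (K * (L * expR (sqnorm e x / 2)) * expR (- sqnorm e x))).
  rewrite ler_wpM2r ?expR_ge0//; apply: (le_trans (HK _ _ e01)).
  by rewrite ler_wpM2l// HL// sqnorm_ge0.
rewrite -!mulrA -expRD ler_wpM2l// ler_wpM2l// ler_expR.
by have := sqnorm_ge0 e x; lra.
Qed.

Lemma measurable_coords k : measurable_fun setT (fun x : R3 R => coords x 0 k).
Proof.
under eq_fun do rewrite mxE.
elim/ord3_ind: k => /=.
- exact: (measurableT_comp measurable_fst measurable_fst).
- exact: (measurableT_comp measurable_snd measurable_fst).
- exact: measurable_snd.
Qed.

Lemma cmeasurableM (u w : R3 R -> C) : cmeasurable u -> cmeasurable w ->
  cmeasurable (fun x => u x * w x).
Proof.
move=> [Ru Iu] [Rw Iw]; split.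
  by under eq_fun do rewrite Re_mulc; apply: measurable_funB; exact: measurable_funM.
by under eq_fun do rewrite Im_mulc; apply: measurable_funD; exact: measurable_funM.
Qed.

Lemma cmeasurable_eval_expr (e : R) p : cmeasurable (fun x => eval_expr e x p).
Proof.
elim: p => [c||k|p IHp q IHq|p IHp q IHq] /=.
- by split; exact: measurable_cst.
- by split; exact: measurable_cst.
- split; last exact: measurable_cst.
  by apply: measurable_funM => //; exact: measurable_coords.
- case: IHp IHq => [Rp Ip] [Rq Iq]; split.
    by under eq_fun do rewrite Re_addc; exact: measurable_funD.
  by under eq_fun do rewrite Im_addc; exact: measurable_funD.
- exact: cmeasurableM.
Qed.

Lemma cmeasurable_packet (e k : R) p : cmeasurable (packet e k p).
Proof.
apply: cmeasurableM; first exact: cmeasurable_eval_expr.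
apply: cmeasurableM.
  by split; [exact: measurable_gauss3|exact: measurable_cst].
have H : measurable_fun setT (fun x : R3 R => k * x.1.1).
  apply: measurable_funM => //.
  exact: (measurableT_comp measurable_fst measurable_fst).
split.
  exact: (measurableT_comp (continuous_measurable_fun (@continuous_cos R)) H).
exact: (measurableT_comp (continuous_measurable_fun (@continuous_sin R)) H).
Qed.

Lemma measurable_cabs2 (u : R3 R -> C) : cmeasurable u ->
  measurable_fun setT (fun x => cabs (u x) ^+ 2).
Proof.
move=> [Ru Iu]; under eq_fun do rewrite cabs2E.
by apply: measurable_funD; exact: measurable_funX.
Qed.

Lemma integral_gauss_dom2 (u : R3 R -> C) e K : 0 < e -> cmeasurable u ->
  (forall x, cabs (u x) <= K * gauss3 e x) ->
  (\int[mu3 R]_x (cabs (u x) ^+ 2)%:E <= (K ^+ 2 * (Num.sqrt pi / e) ^+ 3)%:E)%E.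
Proof.
move=> e0 mu uK.
rewrite EFinM -integral_gauss3// -ge0_integralZl//=; last 3 first.
- by apply/measurable_EFinP; exact: measurable_gauss3.
- by move=> x _; rewrite lee_fin gauss3_ge0.
- by rewrite lee_fin sqr_ge0.
apply: ge0_le_integral => //.
- by move=> x _; rewrite lee_fin sqr_ge0.
- by apply/measurable_EFinP; exact: measurable_cabs2.
- apply/measurable_EFinP; apply: measurable_funM => //; exact: measurable_gauss3.
- by move=> x _; rewrite -EFinM lee_fin sqr_gauss3_dom// cabs_ge0.
Qed.

Lemma Lnorm2E (h : R3 R -> R) :
  ('N[mu3 R]_2%:E [(fun x => (h x)%:E)] =
   (\int[mu3 R]_x (h x ^+ 2)%:E) `^ (2^-1))%E.
Proof.
rewrite unlock /=; congr (_ `^ _)%E; apply: eq_integral => x _.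
by rewrite powR_mulrn ?normr_ge0// real_normK ?num_real.
Qed.

Lemma L2_finite_integral (u : R3 R -> C) : cmeasurable u ->
  (\int[mu3 R]_x (cabs (u x) ^+ 2)%:E < +oo)%E -> L2 u.
Proof.
by move=> mu fu; split=> //; rewrite Lnorm2E; exact: poweR_lty.
Qed.

Lemma L2loc_finite_integral (u : R3 R -> C) : cmeasurable u ->
  (\int[mu3 R]_x (cabs (u x) ^+ 2)%:E < +oo)%E -> L2loc u.
Proof.
move=> mu fu; split=> // K _; apply: le_lt_trans fu.
rewrite integral_mkcond !ge0_integralTE; first last.
- by move=> x; rewrite patchE; case: ifP => // _; rewrite lee_fin sqr_ge0.
- by move=> x; rewrite lee_fin sqr_ge0.
(* Compares the suprema over simple functions that define the two integrals. *)
apply: ereal_sup_le => _ [h /= hK <-]; exists h => //= x.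
apply: (le_trans (hK x)); rewrite patchE; case: ifP => // _.
by rewrite lee_fin sqr_ge0.
Qed.

Section Regularity.
Variables (e k : R) (e01 : 0 < e <= 1).
Implicit Types p : expr R.

Let e2_gt0 : 0 < e / 2. Proof. by case/andP: e01 => *; rewrite divr_gt0. Qed.

Lemma packet_finite p :
  (\int[mu3 R]_x (cabs (packet e k p x) ^+ 2)%:E < +oo)%E.
Proof.
have [K K0 HK] := packet_bound p k.
apply: (le_lt_trans (integral_gauss_dom2 e2_gt0 (cmeasurable_packet e k p) _)).
  by move=> x; exact: HK.
by rewrite ltry.
Qed.

Lemma L2_packet p : L2 (packet e k p).
Proof. exact: (L2_finite_integral (cmeasurable_packet e k p) (packet_finite p)). Qed.

Lemma L2loc_packet p : L2loc (packet e k p).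
Proof. exact: (L2loc_finite_integral (cmeasurable_packet e k p) (packet_finite p)). Qed.

Lemma weak_pd_packet j p : weak_pd j (packet e k p) (packet e k (deriv_packet k j p)).
Proof.
have [K K0 HK] := packet_bound p k.
have [L L0 HL] := packet_bound (deriv_packet k j p) k.
apply: (@weak_pd_line_derive _ j _ _ (packet e k (deriv_packet k j (deriv_packet k j p)))
  (e / 2) (K + L)) => //.
- exact: cmeasurable_packet.
- exact: cmeasurable_packet.
- move=> x; apply: (le_trans (HK _ _ e01)).
  by rewrite ler_wpM2r ?gauss3_ge0// lerDl.
- move=> x; apply: (le_trans (HL _ _ e01)).
  by rewrite ler_wpM2r ?gauss3_ge0// lerDr.
- exact: cline_derive_packet.
- exact: cline_derive_packet.
Qed.

Lemma W12loc_packet p : W12loc (packet e k p) (fun j => packet e k (deriv_packet k j p)).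
Proof.
split; first exact: L2loc_packet.
by move=> j; split; [exact: L2loc_packet|exact: weak_pd_packet].
Qed.

Lemma W22loc_packet p : W22loc (packet e k p) (fun j => packet e k (deriv_packet k j p))
  (fun l j => packet e k (deriv_packet k l (deriv_packet k j p))).
Proof. by split=> [|j]; exact: W12loc_packet. Qed.

End Regularity.

End PacketBounds.

(** * The resonant velocity field *)

Section Construction.
Context (R : realType).
Local Notation C := R[i].
Local Notation J := (0 +i* 1 : C)%C.
Local Open Scope complex_scope.
Local Arguments cabs : simpl never.

Lemma sum_ord3 (V : nmodType) (F : 'I_3 -> V) : \sum_j F j = F 0 + F 1 + F 2.
Proof.
rewrite !big_ord_recl big_ord0 addr0 addrA.
by congr (F _ + F _ + F _); exact: val_inj.
Qed.

Lemma JJ : J * J = -1 :> C.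
Proof. by apply/eqP; rewrite eq_complex /=; apply/andP; split; apply/eqP; ring. Qed.

Lemma imagE (k : R) : 0 +i* k = J * k%:C :> C.
Proof. by apply/eqP; rewrite eq_complex /=; apply/andP; split; apply/eqP; ring. Qed.

(** Y = y_2 + i y_3, the complex coordinate in the plane orthogonal to e_1. *)
Definition Zexpr : expr R := Add (Var R 1) (Mul (Cst J) (Var R 2)).

Definition Zpow (m : nat) : expr R := iter m (Mul Zexpr) (Cst 1).

Lemma eval_deriv0_Zpow e x m : eval_expr e x (deriv_expr 0 (Zpow m)) = 0.
Proof.
by elim: m => [|m IH] //=; rewrite IH; ring.
Qed.

(** The Cauchy-Riemann equation for Y^m. *)
Lemma eval_deriv2_Zpow e x m :
  eval_expr e x (deriv_expr 2 (Zpow m)) = J * eval_expr e x (deriv_expr 1 (Zpow m)).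
Proof.
by elim: m => [|m IH] /=; rewrite ?mulr0// IH; ring.
Qed.

(** The rotation generator (e_1 /\ y) . nabla = y_2 d_3 - y_3 d_2, with y_2 and
y_3 encoded as the variables 1 and 2. *)
Definition angular (p : expr R) : expr R :=
  Add (Mul (Var R 1) (deriv_expr 2 p))
    (Mul (Cst (- 1)) (Mul (Var R 2) (deriv_expr 1 p))).

(** Rotation by theta multiplies Y^m by exp (i m theta). *)
Lemma eval_angular_Zpow e x m :
  eval_expr e x (angular (Zpow m)) = J * m%:R * eval_expr e x (Zpow m).
Proof.
elim: m => [|m /= IH]; first by rewrite /=; ring.
move: IH; rewrite -[m.+1%:R]natr1 /=.
set y2 := (e * _)%:C; set y3 := (e * coords x 0 2)%:C => IH.
set zp := eval_expr e x _; rewrite -/zp in IH.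
apply/eqP; rewrite -subr_eq0.
set d1 := eval_expr e x (deriv_expr 1 _); rewrite -/d1 in IH.
set d2 := eval_expr e x (deriv_expr 2 _); rewrite -/d2 in IH.
(* The difference vanishes modulo the induction hypothesis and J^2 = -1. *)
rewrite (_ : _ - _ = (y2 + J * y3) * (y2 * d2 + -1 * (y3 * d1) - J * m%:R * zp)
   - (J * J + 1) * y3 * zp); last by ring.
by rewrite IH subrr mulr0 JJ addNr !mul0r subr0.
Qed.

Variables (e k : R) (m : nat).

(** a = i k - 2 eps y_1, the logarithmic derivative in x_1 of
exp (i k x_1 - |y|^2). *)
Definition amp : expr R :=
  Add (Cst (0 +i* k)) (Mul (Cst (- 2)) (Mul (Eps R) (Var R 0))).

Definition swirl : expr R := Mul amp (Zpow m).

(** With F = exp (i k x_1 - |y|^2), the last two components are d_1 (Y^m F) (1, i).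
Their divergence is d_1 (d_2 + i d_3) (Y^m F), which equals - d_1 (2 eps Y^(m+1) F)
since only the Gaussian factor contributes, and the first component cancels it. *)
Definition vel_expr (l : 'I_3) : expr R :=
  if l == 0 then Mul (Cst 2) (Mul (Eps R) (Zpow m.+1))
  else if l == 1 then swirl else Mul (Cst J) swirl.

Definition packet_field (q : 'I_3 -> expr R) : vfield R :=
  fun x => \row_l packet e k (q l) x.

Definition vel := packet_field vel_expr.
Definition dvel j := packet_field (fun l => deriv_packet k j (vel_expr l)).
Definition d2vel i j :=
  packet_field (fun l => deriv_packet k i (deriv_packet k j (vel_expr l))).

Lemma cross_e1 (K : pzRingType) (u : 'rV[K]_3) :
  [/\ cross (e1 K) u 0 0 = 0, cross (e1 K) u 0 1 = - u 0 2
    & cross (e1 K) u 0 2 = u 0 1].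
Proof.
have [e1 e2 e3] : [/\ 1 + 1 = 2 :> 'I_3, 1 + 2 = 0 :> 'I_3 & 2 + 1 = 0 :> 'I_3].
  by split; exact: val_inj.
have e4 : 2 + 2 = 1 :> 'I_3 by exact: val_inj.
rewrite /cross; split; rewrite mxE ?add0r ?e1 ?e2 ?e3 ?e4 !mxE /=.
- by rewrite !mul0r subrr.
- by rewrite mul0r mul1r sub0r.
- by rewrite mul0r mul1r subr0.
Qed.

(** The Gaussian is invariant under rotation about e_1, and the phase depends on
x_1 only, so the rotation acts on the polynomial factor alone. *)
Lemma sum_cross_deriv_packet q x :
  \sum_j (cross (e1 R) (coords x) 0 j)%:C * packet e k (deriv_packet k j q) x
  = packet e k (angular q) x.
Proof.
have [c0 c1 c2] := cross_e1 (coords x).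
rewrite sum_ord3 c0 c1 c2 mul0r add0r /packet /=.
rewrite rmorphN !rmorphM/=; ring.
Qed.

Lemma vel_exprE : [/\ vel_expr 0 = Mul (Cst 2) (Mul (Eps R) (Zpow m.+1)), vel_expr 1 = swirl
  & vel_expr 2 = Mul (Cst J) swirl].
Proof. by []. Qed.

Lemma eval_angular_swirl x :
  eval_expr e x (angular swirl) = J * m%:R * eval_expr e x swirl.
Proof.
have := eval_angular_Zpow e x m; rewrite /swirl /amp /=.
set y1 := (e * coords x 0 1)%:C; set y2 := (e * coords x 0 2)%:C.
set zp := eval_expr e x (Zpow m); set d1 := eval_expr e x (deriv_expr 1 (Zpow m)).
set d2 := eval_expr e x (deriv_expr 2 (Zpow m)) => H.
rewrite [LHS](_ : _ = (k*i + -2 * (e%:C * (e * coords x 0 0)%:C)) *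
  (y1 * d2 + -1 * (y2 * d1))); last by ring.
by rewrite H; ring.
Qed.

(** R vel = - i (m + 1) vel. The first component has angular momentum m + 1. The
other two have angular momentum m, and e_1 /\ _ multiplies (0, 1, i) by - i, which
adds the missing unit. *)
Lemma isrot_vel omega (s delta : R) x : s = omega * m.+1%:R + delta ->
  isrot omega s vel dvel x = (0 +i* delta) *: vel x.
Proof.
move=> sE.
have sumE l : (\sum_j (cross (e1 R) (coords x) 0 j)%:C *: dvel j x) 0 l
    = packet e k (angular (vel_expr l)) x.
  rewrite summxE -sum_cross_deriv_packet; apply: eq_bigr => j _.
  by rewrite !mxE.
have [c0 c1 c2] := cross_e1 (vel x).
apply/rowP => l; rewrite /isrot /rotop.
have -> (a b c : 'rV[C]_3) (z w : C) : (z *: a + w *: (b - c)) 0 l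
   = z * a 0 l + w * (b 0 l - c 0 l) by rewrite !mxE.
rewrite sumE [RHS]mxE (imagE s) (imagE delta) sE -[m.+1%:R]natr1.
rewrite rmorphD rmorphM/= rmorphD/= rmorph_nat.
rewrite /packet; set F := (gauss3 e x)%:C * phase k x.
have [v0 v1 v2] := vel_exprE.
elim/ord3_ind: l.
- rewrite c0 ![vel x 0 _]mxE /packet -/F v0.
  have -> : eval_expr e x (angular (Mul (Cst 2) (Mul (Eps R) (Zpow m.+1)))) =
      2 * e%:C * eval_expr e x (angular (Zpow m.+1)).
    by rewrite /=; ring.
  by rewrite eval_angular_Zpow -[m.+1%:R]natr1 /=; ring.
- rewrite c1 ![vel x 0 _]mxE /packet -/F v1 v2 eval_angular_swirl.
  have -> : eval_expr e x (Mul (Cst J) swirl) = J * eval_expr e x swirl by [].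
  by ring.
- rewrite c2 ![vel x 0 _]mxE /packet -/F v1 v2.
  have -> : eval_expr e x (angular (Mul (Cst J) swirl)) =
      J * eval_expr e x (angular swirl).
    by rewrite /angular /=; ring.
  have -> : eval_expr e x (Mul (Cst J) swirl) = J * eval_expr e x swirl by [].
  rewrite eval_angular_swirl; set h := eval_expr e x swirl.
  rewrite [LHS](_ : _ = (J * (omega%:C * (m%:R + 1) + delta%:C)) * (J * h * F) +
     omega%:C * (- (-1) * (h * F) - (J * m%:R * (J * h)) * F)); last by ring.
  (* With 1 written as - J^2, both sides agree as polynomials in J. *)
  by rewrite -[in - (-1)]JJ; ring.
Qed.

Lemma div_vel x : \sum_j dvel j x 0 j = 0.
Proof.
rewrite sum_ord3 ![dvel _ x 0 _]mxE /packet; set F := (gauss3 e x)%:C * phase k x.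
have [-> -> ->] := vel_exprE; rewrite /deriv_packet /deriv_gauss /swirl /amp /=.
have := eval_deriv0_Zpow e x m; have := eval_deriv2_Zpow e x m.
set zp := eval_expr e x (Zpow m); set d0 := eval_expr e x (deriv_expr 0 (Zpow m)).
set d1 := eval_expr e x (deriv_expr 1 (Zpow m)).
set d2 := eval_expr e x (deriv_expr 2 (Zpow m)).
move=> -> ->; rewrite (imagE k).
set y0 := (e * coords x 0 0)%:C.
rewrite [LHS](_ : _ = (J * J + 1) *
  (e%:C * (J * k%:C + -2 * (e%:C * y0)) * d1 * F)); last by ring.
by rewrite JJ addNr mul0r.
Qed.

(** The polynomial factor of (i lambda k - Delta - lambda d_1 - k^2) u, where u is
the packet with factor q, divided by eps. *)
Definition defect_expr (lambda : R) (q : expr R) : expr R :=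
  Add (Mul (Cst (- lambda%:C - 2 * J * k%:C)) (deriv_gauss 0 q))
    (Mul (Cst (-1)) (Mul (Eps R) (Add (deriv_gauss 0 (deriv_gauss 0 q))
      (Add (deriv_gauss 1 (deriv_gauss 1 q)) (deriv_gauss 2 (deriv_gauss 2 q)))))).

Definition force_expr lambda (l : 'I_3) : expr R :=
  Add (Mul (Cst (k ^+ 2)%:C) (vel_expr l))
    (Mul (Eps R) (defect_expr lambda (vel_expr l))).

Definition force lambda := packet_field (force_expr lambda).

(** Among the terms without a factor eps, i lambda k cancels against - lambda d_1
of the phase, and - Delta of the phase leaves k^2. *)
Lemma packet_balance lambda q x :
  (0 +i* (lambda * k)) * packet e k q x
  - \sum_j packet e k (deriv_packet k j (deriv_packet k j q)) x
  - lambda%:C * packet e k (deriv_packet k 0 q) x =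
  (k ^+ 2)%:C * packet e k q x + packet e k (Mul (Eps R) (defect_expr lambda q)) x.
Proof.
rewrite sum_ord3 /packet; set F := (gauss3 e x)%:C * phase k x.
rewrite /defect_expr /deriv_packet /deriv_gauss /=.
rewrite (imagE k) (imagE (lambda * k)) !rmorphM/=.
apply/eqP; rewrite -subr_eq0.
rewrite (_ : _ - _ = (J * J + 1) * (- (k%:C * k%:C * eval_expr e x q * F))); last by ring.
by rewrite JJ addNr mul0r.
Qed.

End Construction.

(** * The force is comparable to k^2 times the velocity *)

Section Estimates.
Context (R : realType).
Local Notation mu := (@lebesgue_measure R).
Local Notation C := R[i].
Local Open Scope complex_scope.
Local Arguments cabs : simpl never.

Definition sqmod (f : vfield R) (x : R3 R) : R := \sum_l cabs (f x 0 l) ^+ 2.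

(** The square of the L^2 norm. *)
Definition energy (f : vfield R) : \bar R := (\int[mu3 R]_x (sqmod f x)%:E)%E.

Lemma sqmod_ge0 f x : 0 <= sqmod f x.
Proof. by apply: sumr_ge0 => l _; exact: sqr_ge0. Qed.

Lemma L2normE f : L2norm f = (energy f `^ (2^-1))%E.
Proof.
rewrite /L2norm Lnorm2E /energy; congr (_ `^ _)%E.
by apply: eq_integral => x _; rewrite sqr_sqrtr// sqmod_ge0.
Qed.

Lemma L2norm_ge_scale (c : R) f h : 0 <= c ->
  ((c ^+ 2)%:E * energy f <= energy h)%E -> (c%:E * L2norm f <= L2norm h)%E.
Proof.
move=> c0 fh; have nn g : (0 <= energy g)%E.
  by apply: integral_ge0 => x _; rewrite lee_fin sqmod_ge0.
rewrite !L2normE.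
have -> : (c%:E = (c ^+ 2)%:E `^ (2^-1))%E.
  by rewrite poweR_EFin -powR_mulrn// -powRrM mulfV// powRr1.
rewrite -poweRM ?lee_fin ?sqr_ge0//.
apply: gt0_ler_poweR => //; rewrite in_itv/= leey andbT ?nn//.
by rewrite mule_ge0 ?nn// lee_fin sqr_ge0.
Qed.

Lemma energyZ (z : C) f : measurable_fun setT (sqmod f) ->
  energy (fun x => z *: f x) = ((cabs z ^+ 2)%:E * energy f)%E.
Proof.
move=> mf; rewrite /energy -ge0_integralZl//; last 3 first.
- exact/measurable_EFinP.
- by move=> x _; rewrite lee_fin sqmod_ge0.
- by rewrite lee_fin sqr_ge0.
apply: eq_integral => x _; rewrite -EFinM /sqmod mulr_sumr; congr EFin.
by apply: eq_bigr => l _; rewrite mxE cabsM exprMn.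
Qed.

Lemma energy_comb (f g h : vfield R) (c d : R) : 0 <= c -> 0 <= d ->
  measurable_fun setT (sqmod f) -> measurable_fun setT (sqmod g) ->
  measurable_fun setT (sqmod h) ->
  (forall x, sqmod h x <= c * sqmod f x + d * sqmod g x) ->
  (energy h <= c%:E * energy f + d%:E * energy g)%E.
Proof.
move=> c0 d0 mf mg mh hfg; rewrite /energy.
have nn f' x : (0 <= (sqmod f' x)%:E)%E by rewrite lee_fin sqmod_ge0.
have Z c' f' : 0 <= c' -> measurable_fun setT (sqmod f') ->
    (c'%:E * \int[mu3 R]_x (sqmod f' x)%:E = \int[mu3 R]_x (c'%:E * (sqmod f' x)%:E))%E.
  by move=> c'0 mf'; rewrite ge0_integralZl ?lee_fin//; exact/measurable_EFinP.
rewrite !Z//.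
rewrite -ge0_integralD//; first last.
- by apply/measurable_EFinP; exact: measurable_funM.
- by move=> x _; rewrite mule_ge0.
- by apply/measurable_EFinP; exact: measurable_funM.
- by move=> x _; rewrite mule_ge0.
apply: ge0_le_integral => //.
- exact/measurable_EFinP.
- by apply/measurable_EFinP/measurable_funD; exact: measurable_funM.
- by move=> x _; rewrite -!EFinM -EFinD lee_fin.
Qed.

Lemma cabs2D_le (z w : C) : cabs (z + w) ^+ 2 <= 2 * cabs z ^+ 2 + 2 * cabs w ^+ 2.
Proof.
rewrite !cabs2E Re_addc Im_addc.
have H (a b : R) : (a + b) ^+ 2 <= 2 * a ^+ 2 + 2 * b ^+ 2.
  by have := sqr_ge0 (a - b); lra.
have := H (complex.Re z) (complex.Re w); have := H (complex.Im z) (complex.Im w).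
by lra.
Qed.

Lemma sqmodD_le (a b : R3 R -> 'rV[C]_3) x :
  sqmod (fun x => a x + b x) x <= 2 * sqmod a x + 2 * sqmod b x.
Proof.
rewrite /sqmod !mulr_sumr -big_split/=; apply: ler_sum => l _.
by rewrite mxE cabs2D_le.
Qed.

Lemma measurable_sqmod_packet e k q : measurable_fun setT (sqmod (@packet_field R e k q)).
Proof.
have H l : measurable_fun setT (fun x => cabs (packet_field e k q x 0 l) ^+ 2).
  apply: measurable_cabs2.
  have -> : (fun x => packet_field e k q x 0 l) = packet e k (q l).
    by apply/funext => x; rewrite mxE.
  exact: cmeasurable_packet.
have -> : sqmod (packet_field e k q) = fun x => cabs (packet_field e k q x 0 0) ^+ 2 +
   cabs (packet_field e k q x 0 1) ^+ 2 + cabs (packet_field e k q x 0 2) ^+ 2.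
  by apply/funext => x; rewrite /sqmod sum_ord3.
by apply: measurable_funD => //; exact: measurable_funD.
Qed.

Lemma energy_packet_le (k : R) q : exists2 A : R, 0 <= A &
  forall e, 0 < e <= 1 -> (energy (packet_field e k q) <= (A / e ^+ 3)%:E)%E.
Proof.
have [K0 K00 H0] := packet_bound (q 0) k.
have [K1 K10 H1] := packet_bound (q 1) k.
have [K2 K20 H2] := packet_bound (q 2) k.
pose B := K0 ^+ 2 + K1 ^+ 2 + K2 ^+ 2.
have B0 : 0 <= B by rewrite !addr_ge0 ?sqr_ge0.
exists (B * (2 * Num.sqrt pi) ^+ 3) => [|e e01].
  by rewrite mulr_ge0// exprn_ge0// mulr_ge0// sqrtr_ge0.
have e0 : 0 < e by case/andP: e01.
have -> : B * (2 * Num.sqrt pi) ^+ 3 / e ^+ 3 = B * (Num.sqrt pi / (e / 2)) ^+ 3.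
  by field; rewrite gt_eqF.
rewrite EFinM -integral_gauss3 ?divr_gt0// -ge0_integralZl//; last 2 first.
- by apply/measurable_EFinP; exact: measurable_gauss3.
- by move=> x _; rewrite lee_fin gauss3_ge0.
apply: ge0_le_integral => //.
- by move=> x _; rewrite lee_fin sqmod_ge0.
- by apply/measurable_EFinP; exact: measurable_sqmod_packet.
- by apply/measurable_EFinP; apply: measurable_funM => //; exact: measurable_gauss3.
move=> x _; rewrite -EFinM lee_fin /sqmod sum_ord3 !mxE.
rewrite /B !mulrDl; apply: lerD; [apply: lerD|]; apply: sqr_gauss3_dom => //;
  by rewrite ?cabs_ge0 ?H0 ?H1 ?H2.
Qed.

Lemma mu3_cube (a b : R) : a <= b ->
  mu3 R ((`[a, b]%classic `*` `[a, b]%classic) `*` `[a, b]%classic) = ((b - a) ^+ 3)%:E.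
Proof.
move=> ab; have I : mu `[a, b]%classic = (b - a)%:E.
  by rewrite lebesgue_measure_itv/= lte_fin; case: ltgtP ab => // -> _; rewrite subrr.
have mI : measurable (`[a, b]%classic : set (measurableTypeR R)).
  exact: measurable_itv.
transitivity (mu2 (`[a, b]%classic `*` `[a, b]%classic) * mu `[a, b]%classic)%E.
  exact: (@product_measure1E _ _ _ _ _ (@mu2 R) mu _ _ (measurableX mI mI) mI).
have -> : (mu2 (`[a, b]%classic `*` `[a, b]%classic) = ((b - a) ^+ 2)%:E)%E.
  transitivity (mu `[a, b]%classic * mu `[a, b]%classic)%E.
    exact: (@product_measure1E _ _ _ _ _ mu mu _ _ mI mI).
  by rewrite I -EFinM expr2.
by rewrite I -EFinM -exprSr.
Qed.

Lemma cabs_Zpow_ge1 (e : R) x m : 1 <= e * x.1.2 -> 1 <= cabs (eval_expr e x (Zpow R m)).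
Proof.
move=> y1; elim: m => [|m IH].
  by rewrite /= (_ : (1 : C) = (1 : R)%:C)// cabs_real normr1.
rewrite [Zpow _ _]/= -/(Zpow R m) [eval_expr _ _ _]/= cabsM.
apply: (@le_trans _ _ (1 * 1)); first by rewrite mulr1.
apply: ler_pM => //; apply: le_trans (normRe_le _).
rewrite Re_addc Re_mulc/= !mxE/= mulr0 mul0r subr0 addr0.
by apply: (le_trans y1); exact: ler_norm.
Qed.

(** On the cube 1 <= y_j <= 2 of volume eps^-3 one has |a| >= |Im a| = |k|,
|Y| >= y_2 >= 1 and |y|^2 <= 12, so the second component is at least
|k| exp (- 12) there. *)
Lemma energy_vel_ge (e k : R) m : 0 < e <= 1 ->
  ((k ^+ 2 * expR (- 24) / e ^+ 3)%:E <= energy (vel e k m))%E.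
Proof.
move=> /andP[e0 e1].
pose I := `[e^-1, 2 * e^-1]%classic.
pose B : set (R3 R) := (I `*` I) `*` I.
have mI : measurable (I : set (measurableTypeR R)) by exact: measurable_itv.
have mB : measurable B by exact: (measurableX (measurableX mI mI) mI).
have mV : measurable_fun setT (fun x => (sqmod (vel e k m) x)%:E).
  by apply/measurable_EFinP; exact: measurable_sqmod_packet.
have -> : ((k ^+ 2 * expR (- 24) / e ^+ 3)%:E =
    \int[mu3 R]_(x in B) (k ^+ 2 * expR (- 24))%:E)%E.
  rewrite integral_cst// mu3_cube -?EFinM; last first.
    by apply: ler_peMl; [rewrite invr_ge0 ltW|rewrite ler1n].
  by congr EFin; field; rewrite gt_eqF.
apply: (@le_trans _ _ (\int[mu3 R]_(x in B) (sqmod (vel e k m) x)%:E)%E); last first.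
  apply: ge0_subset_integral => // x _; by rewrite lee_fin sqmod_ge0.
apply: ge0_le_integral => //.
- by move=> x _; rewrite lee_fin mulr_ge0 ?sqr_ge0 ?expR_ge0.
- exact: measurable_funTS.
move=> -[[a b] c] [[/=]]; rewrite /I/= !in_itv/=.
move=> /andP[a1 a2] /andP[b1 b2] /andP[c1 c2]; rewrite lee_fin.
set x : R3 R := (a, b, c).
have bnd t : e^-1 <= t -> t <= 2 * e^-1 -> 1 <= e * t /\ (e * t) ^+ 2 <= 4.
  move=> t1 t2; have et1 : 1 <= e * t by rewrite mulrC -ler_pdivrMr// div1r.
  split=> //; have et2 : e * t <= 2 by rewrite mulrC -ler_pdivlMr.
  by nra.
have [_ A2] := bnd a a1 a2; have [B1 B2] := bnd b b1 b2; have [_ C2] := bnd c c1 c2.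
apply: (@le_trans _ _ (cabs (vel e k m x 0 1) ^+ 2)); last first.
  by rewrite /sqmod sum_ord3 addrAC lerDr addr_ge0 ?sqr_ge0.
rewrite [vel _ _ _ x 0 1]mxE (_ : vel_expr k m 1 = Mul (amp k) (Zpow R m))//.
rewrite /packet [eval_expr _ _ _]/= !cabsM cabs_phase mulr1 cabs_real.
rewrite ger0_norm ?gauss3_ge0// exprMn [X in _ <= X * _]exprMn.
have Im_amp : complex.Im (eval_expr e x (amp k)) = k.
  by rewrite /amp [eval_expr _ _ _]/= Im_addc !Im_mulc !Re_mulc /=; ring.
apply: ler_pM; rewrite ?sqr_ge0 ?expR_ge0//.
  rewrite -[leLHS]mulr1; apply: ler_pM; rewrite ?sqr_ge0//.
    by rewrite cabs2E Im_amp lerDr sqr_ge0.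
  by rewrite exprn_ege1// cabs_Zpow_ge1.
rewrite gauss3E -expRM_natl ler_expR /sqnorm /=.
by lra.
Qed.

(** Both sides are of order eps^-3 times a constant independent of eps, with the
additional factor eps^2 on the left. *)
Lemma small_defect (lambda k : R) m : k != 0 ->
  exists e, [/\ 0 < e <= 1, (0 < energy (vel e k m))%E,
    (energy (vel e k m) < +oo)%E &
    (energy (packet_field e k
       (fun l => Mul (Eps R) (defect_expr k lambda (vel_expr k m l))))
      <= (k ^+ 4 / 4)%:E * energy (vel e k m))%E].
Proof.
move=> k0.
have [A A0 HA] := energy_packet_le k (fun l => defect_expr k lambda (vel_expr k m l)).
have [V V0 HV] := energy_packet_le k (vel_expr k m).
pose c : R := k ^+ 4 / 4 * (k ^+ 2 * expR (- 24)).
have k2 : 0 < k ^+ 2 by rewrite exprn_even_gt0.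
have c0 : 0 < c.
  have k4 : 0 < k ^+ 4 by rewrite exprn_even_gt0.
  by apply: mulr_gt0; [exact: divr_gt0|exact: mulr_gt0 k2 (expR_gt0 _)].
have Ac : 0 < A + c by rewrite ltr_wpDl.
(* The inequality reduces to e^2 A <= c, and here e <= 1 and e A <= c. *)
pose e := c / (A + c).
have e0 : 0 < e by rewrite divr_gt0.
have e1 : e <= 1 by rewrite ler_pdivrMr// mul1r lerDr.
have e01 : 0 < e <= 1 by rewrite e0.
exists e; split=> //.
- apply: lt_le_trans (energy_vel_ge k m e01).
  by rewrite lte_fin divr_gt0 ?exprn_gt0// mulr_gt0// expR_gt0.
- by apply: (le_lt_trans (HV _ e01)); rewrite ltry.
have -> : packet_field e k
      (fun l => Mul (Eps R) (defect_expr k lambda (vel_expr k m l))) =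
    (fun x => e%:C *: packet_field e k
      (fun l => defect_expr k lambda (vel_expr k m l)) x).
  by apply/funext => x; apply/rowP => l; rewrite !mxE /packet /= !mulrA.
rewrite energyZ; last exact: measurable_sqmod_packet.
apply: (@le_trans _ _ ((e ^+ 2)%:E * (A / e ^+ 3)%:E)%E).
  rewrite cabs_real gtr0_norm//; apply: lee_wpmul2l; last exact: HA.
  by rewrite lee_fin sqr_ge0.
apply: (@le_trans _ _ ((k ^+ 4 / 4)%:E * (k ^+ 2 * expR (- 24) / e ^+ 3)%:E)%E); last first.
  apply: lee_wpmul2l; last exact: energy_vel_ge.
  by rewrite lee_fin divr_ge0// exprn_even_ge0.
rewrite -!EFinM lee_fin mulrA [leRHS]mulrA.
apply: ler_wpM2r; first by rewrite invr_ge0 exprn_ge0// ltW.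
rewrite -/c; apply: (@le_trans _ _ (e * A)).
  by apply: ler_wpM2r => //; rewrite expr2 ler_piMl// ltW.
have c1 := ltW c0.
by rewrite /e mulrAC ler_pdivrMr// ler_wpM2l// lerDl.
Qed.

End Estimates.

(** * Resonant solutions and the choice of the frequencies *)

Section Resonance.
Context (R : realType).
Local Notation C := R[i].
Local Open Scope complex_scope.
Local Arguments cabs : simpl never.

Lemma W12loc0 : W12loc (fun=> 0 : C) (fun=> fun=> 0).
Proof.
have L0 : L2loc (fun _ : R3 R => 0 : C).
  apply: L2loc_finite_integral; first by split; exact: measurable_cst.
  rewrite integral0_eq ?ltry// => x _.
  by rewrite (_ : (0 : C) = (0 : R)%:C)// cabs_real normr0 expr0n.
split=> // j; split=> // phi _.
rewrite /cintegral; have E (r : R) : (0 : C) * r%:C = 0 by rewrite mul0r.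
under eq_Rintegral do rewrite E.
under [X in (_ +i* X)%C = _]eq_Rintegral do rewrite E.
under [X in _ = - (X +i* _)%C]eq_Rintegral do rewrite E.
under [X in _ = - (_ +i* X)%C]eq_Rintegral do rewrite E.
by rewrite /Rintegral integral0/= oppr0.
Qed.

(** With V and r the squared norms of v and of g - k^2 v, [small_defect] gives
r <= k^4 V / 4. Then |g|^2 <= 2 k^4 V + 2 r <= 4 k^4 V, which is the bound, and
k^4 V <= 2 |g|^2 + 2 r prevents g from vanishing. *)
Lemma resonant_solution (lambda omega k : R) (m : nat) : 0 < lambda -> k != 0 ->
  exists (g v : vfield R) (Dv : 'I_3 -> vfield R) (D2v : 'I_3 -> 'I_3 -> vfield R),
  let s := omega * m.+1%:R + lambda * k in
  [/\ L2v g /\ nonzero_field g, W22locv v Dv D2v,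
     oseen_sol lambda omega s v Dv D2v (fun=> fun=> 0) g,
     [/\ forall j l, L2v (D2v j l), L2v (isrot omega s v Dv) & L2v (Dv 0)] &
     ((lambda / (2 * `|k|))%:E * L2norm g <= L2norm (isrot omega s v Dv))%E].
Proof.
move=> lambda0 k0.
have [e [e01 V0 Vfin small]] := small_defect lambda m k0.
set rem := packet_field _ _ _ in small.
exists (force e k m lambda), (vel e k m), (dvel e k m), (d2vel e k m) => s.
have rotE x : isrot omega s (vel e k m) (dvel e k m) x = (0 +i* (lambda * k)) *: vel e k m x.
  exact: isrot_vel.
have rotfE : isrot omega s (vel e k m) (dvel e k m) =
    fun x => (0 +i* (lambda * k)) *: vel e k m x by apply/funext.
have L2row q : L2v (packet_field e k q).
  move=> l; have -> : vcomp l (packet_field e k q) = packet e k (q l).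
    by apply/funext => x; rewrite /vcomp mxE.
  exact: L2_packet.
have gE x : force e k m lambda x = (k ^+ 2)%:C *: vel e k m x + rem x.
  by apply/rowP => l; rewrite !mxE /packet /= mulrDl -!mulrA.
have mV := measurable_sqmod_packet e k (vel_expr k m).
have mG := measurable_sqmod_packet e k (force_expr k m lambda).
have mR := measurable_sqmod_packet e k
  (fun l => Mul (Eps R) (defect_expr k lambda (vel_expr k m l))).
have k4 : cabs (k ^+ 2)%:C ^+ 2 = k ^+ 4.
  by rewrite cabs_real ger0_norm ?sqr_ge0// -exprM.
have sqZ (z : C) (f : vfield R) x : sqmod (fun y => z *: f y) x = cabs z ^+ 2 * sqmod f x.
  by rewrite /sqmod mulr_sumr; apply: eq_bigr => l _; rewrite mxE cabsM exprMn.
have k4ge : 0 <= k ^+ 4 by rewrite exprn_even_ge0.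
have Gle : (energy (force e k m lambda) <=
    (2 * k ^+ 4)%:E * energy (vel e k m) + 2%:E * energy rem)%E.
  apply: energy_comb => //; first exact: mulr_ge0.
  move=> x; have := sqmodD_le (fun y => (k ^+ 2)%:C *: vel e k m y) rem x.
  rewrite (sqZ (k ^+ 2)%:C (vel e k m)) k4 mulrA => /(le_trans _); apply.
  by rewrite /sqmod; under eq_bigr do rewrite gE.
have Vle : (energy (fun x => (k ^+ 2)%:C *: vel e k m x) <=
    2%:E * energy (force e k m lambda) + 2%:E * energy rem)%E.
  apply: energy_comb => //.
    rewrite (_ : sqmod _ = fun x => k ^+ 4 * sqmod (vel e k m) x).
      exact: measurable_funM.
    by apply/funext => x; rewrite sqZ k4.
  move=> x; have := sqmodD_le (force e k m lambda) (fun y => (-1) *: rem y) x.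
  rewrite (sqZ (-1) rem) (_ : cabs (-1) ^+ 2 = 1) ?mul1r; last first.
    by rewrite (_ : (-1 : C) = (-1 : R)%:C) ?cabs_real ?normrN ?normr1 ?expr1n// rmorphN.
  move=> /(le_trans _); apply; rewrite /sqmod.
  by under [leRHS]eq_bigr do rewrite gE scaleN1r addrK.
have Vfn : energy (vel e k m) \is a fin_num.
  by rewrite ge0_fin_numE// ltW.
move: V0 small Gle Vle; rewrite energyZ// k4 -(fineK Vfn).
set a := fine _; rewrite lte_fin => a0 small Gle Vle.
have remle : (energy rem <= (k ^+ 4 / 4 * a)%:E)%E by rewrite EFinM.
split.
- split; first exact: L2row.
  move=> g0.
  have G0 : energy (force e k m lambda) = 0%E.
    rewrite /energy (ae_eq_integral (cst 0%E) _ measurableT) ?integral0//.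
      exact/measurable_EFinP.
    apply: filterS g0 => x gx _; rewrite /sqmod gx big1// => l _.
    by rewrite mxE (_ : (0 : C) = (0 : R)%:C)// cabs_real normr0 expr0n.
  move: Vle; rewrite G0 mule0 add0e; apply/negP; rewrite -ltNge.
  apply: (@le_lt_trans _ _ (2%:E * (k ^+ 4 / 4 * a)%:E)%E).
    exact: lee_wpmul2l.
  rewrite -!EFinM lte_fin.
  have : 0 < k ^+ 4 * a by rewrite mulr_gt0// exprn_even_gt0.
  by lra.
- move=> l.
  have := W22loc_packet k e01 (vel_expr k m l).
  have E q : vcomp l (packet_field e k q) = packet e k (q l).
    by apply/funext => x; rewrite /vcomp mxE.
  rewrite /vel E.
  have -> : (fun j => vcomp l (dvel e k m j)) =
      (fun j => packet e k (deriv_packet k j (vel_expr k m l))).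
    by apply/funext => j; rewrite /dvel E.
  have -> // : (fun i j => vcomp l (d2vel e k m i j)) =
     (fun i j => packet e k (deriv_packet k i (deriv_packet k j (vel_expr k m l)))).
  by apply/funext => i; apply/funext => j; rewrite /d2vel E.
- split; apply: aeW => x; last exact: div_vel.
  rewrite rotE; apply/rowP => l.
  have := packet_balance e k lambda (vel_expr k m l) x.
  rewrite !mxE addr0 summxE.
  under [in X in _ -> X]eq_bigr do rewrite mxE.
  by move=> ->; rewrite /packet /=; ring.
- split=> [j l||]; [exact: L2row| |exact: L2row].
  rewrite rotfE (_ : (fun x => _) = packet_field e k
    (fun l => Mul (Cst (0 +i* (lambda * k))) (vel_expr k m l))); first exact: L2row.
  by apply/funext => x; apply/rowP => l; rewrite !mxE /packet /= !mulrA.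
- rewrite rotfE; apply: L2norm_ge_scale.
    by rewrite divr_ge0 ?mulr_ge0// ltW.
  rewrite energyZ// -(fineK Vfn) -/a.
  have -> : cabs (0 +i* (lambda * k)) ^+ 2 = (lambda * k) ^+ 2.
    by rewrite cabs2E /= expr0n add0r.
  apply: (@le_trans _ _ (((lambda / (2 * `|k|)) ^+ 2)%:E * (4 * k ^+ 4 * a)%:E)%E).
    apply: lee_wpmul2l; first by rewrite lee_fin sqr_ge0.
    apply: (le_trans Gle).
    apply: (@le_trans _ _ ((2 * k ^+ 4)%:E * a%:E + 2%:E * (k ^+ 4 / 4 * a)%:E)%E).
      by apply: leeD => //; exact: lee_wpmul2l.
    rewrite -!EFinM -EFinD lee_fin.
    have : 0 <= k ^+ 4 * a by rewrite mulr_ge0// ltW.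
    by lra.
  rewrite -!EFinM lee_fin le_eqVlt; apply/orP; left; apply/eqP.
  rewrite exprMn exprVn exprMn real_normK ?num_real//.
  by field.
Qed.

(** Dirichlet's argument: among the fractional parts of j beta, 0 <= j <= N, with
beta = alpha / omega, two lie in the same interval of length 1/N. Irrationality
makes the difference nonzero, and N > 1 / beta makes the integer part positive. *)
Lemma small_linear_form (alpha omega eta : R) : 0 < alpha -> 0 < omega ->
  irrational (alpha / omega) -> 0 < eta ->
  exists (z m : nat) (delta : R), [/\ alpha * z%:R = omega * m.+1%:R + delta,
    delta != 0 & `|delta| <= eta].
Proof.
move=> al0 om0 irr eta0; set beta := alpha / omega in irr.
have be0 : 0 < beta by rewrite divr_gt0.
pose N := (Num.truncn (beta^-1 + omega / eta)).+1.
have N0 : 0 < N%:R :> R by rewrite ltr0n.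
have HN : beta^-1 + omega / eta < N%:R by exact: truncnS_gt.
have bi0 : 0 < beta^-1 by rewrite invr_gt0.
have oe0 : 0 < omega / eta by rewrite divr_gt0.
have Nb : N%:R^-1 < beta.
  by rewrite -(invrK beta) ltf_pV2 ?posrE//; lra.
have Ne : omega / N%:R <= eta.
  by rewrite ler_pdivrMr// mulrC -ler_pdivrMr//; lra.
pose fl (j : 'I_N.+1) : int := Num.floor (beta * j%:R).
pose fr (j : 'I_N.+1) : R := beta * j%:R - (fl j)%:~R.
have fr0 j : 0 <= fr j by rewrite subr_ge0 floor_le.
have fr1 j : fr j < 1.
  by have := floorD1_gt (beta * j%:R); rewrite intrD /fr /fl; lra.
have trN j : (Num.truncn (N%:R * fr j) < N)%N.
  rewrite truncn_lt_nat ?mulr_ge0//.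
  by rewrite -[ltRHS]mulr1 ltr_pM2l.
pose slot j := Ordinal (trN j).
have /injectivePn [i [j ij sij]] : ~~ injectiveb slot.
  apply/negP => /injectiveP /leq_card.
  by rewrite !card_ord ltnn.
wlog lt_ij : i j ij sij / (i < j)%N.
  move=> W; have [ij'|ji|ij'] := ltngtP i j.
  - exact: (W i j).
  - by apply: (W j i) => //; rewrite eq_sym.
  - by move/eqP: ij; case; exact: val_inj.
have close : `|fr j - fr i| < N%:R^-1.
  have /(congr1 val) /= T := sij.
  have /andP[i1 i2] := truncn_itv (mulr_ge0 (ltW N0) (fr0 i)).
  have /andP[j1 j2] := truncn_itv (mulr_ge0 (ltW N0) (fr0 j)).
  rewrite T in i1 i2; rewrite -natr1 in i2 j2 *.
  rewrite -[X in _ < X]mulr1 -ltr_pdivrMl ?invr_gt0// invrK.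
  rewrite -[N%:R](gtr0_norm N0) -normrM ltr_norml mulrBr.
  by apply/andP; split; lra.
pose z := (j - i)%N.
pose th := fr j - fr i; pose p := fl j - fl i.
have zE : beta * z%:R = p%:~R + th.
  by rewrite /z natrB ?(ltnW lt_ij)// /p /th /fr intrD rmorphN/=; ring.
have z1 : 1 <= z%:R :> R by rewrite ler1n subn_gt0.
have p0 : 0 < p.
  rewrite -(ltr_int R) mulr0z.
  have : beta <= beta * z%:R by rewrite ler_peMr// ltW.
  have thN : th < N%:R^-1 := le_lt_trans (ler_norm th) close.
  by lra.
have [m pE] : exists m : nat, p = m.+1%:Z.
  by exists `|p|.-1%N; rewrite prednK ?absz_gt0 ?gt_eqF// gtz0_abs.
exists z, m, (omega * th); split.
- have -> : alpha = omega * beta by rewrite /beta mulrC divfK// gt_eqF.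
  by rewrite -mulrA zE pE mulrDr.
- apply: mulf_neq0; first by rewrite gt_eqF.
  apply/eqP => th0.
  apply: irr; apply/rationalP; exists p, z.
  have z0 : z%:R != 0 :> R by rewrite gt_eqF// (lt_le_trans _ z1).
  by apply: (mulIf z0); rewrite divfK// zE th0 addr0.
- rewrite normrM gtr0_norm//; apply: le_trans Ne.
  by rewrite ler_wpM2l// ltW.
Qed.

(** With kappa = delta / lambda, the bound |kappa| <= 1 / (n + 1) gives
n^(1/2) |kappa| <= 1, hence C = lambda / 2. *)
Lemma counterexample_resonant (lambda omega : R) (s : nat -> R) : 0 < lambda ->
  (forall n, exists m delta, [/\ s n = omega * m.+1%:R + delta, delta != 0 &
     `|delta| <= lambda / n.+1%:R]) ->
  counterexample lambda omega s.
Proof.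
move=> la0 Hs.
have H n : exists w : vfield R * vfield R * ('I_3 -> vfield R) *
    ('I_3 -> 'I_3 -> vfield R),
  let: (g, v, Dv, D2v) := w in
  [/\ [/\ L2v g /\ nonzero_field g,
     W22locv v Dv D2v /\ W12loc (fun=> 0 : C) (fun=> fun=> 0),
     oseen_sol lambda omega (s n) v Dv D2v (fun=> fun=> 0) g &
     [/\ forall j l, L2v (D2v j l), L2v (isrot omega (s n) v Dv) & L2v (Dv 0)]] &
     ((lambda / 2 * Num.sqrt n%:R)%:E * L2norm g
       <= L2norm (isrot omega (s n) v Dv))%E].
  have [m [delta [sE d0 dle]]] := Hs n.
  have la0' : lambda != 0 by rewrite gt_eqF.
  have k0 : delta / lambda != 0 by rewrite mulf_neq0// invr_eq0.
  have [g [v [Dv [D2v]]]] := resonant_solution omega m la0 k0.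
  rewrite (_ : lambda * _ = delta) -?sE; last by rewrite mulrC divfK.
  move=> [g_ v_ eq_ reg_ bd].
  exists (g, v, Dv, D2v); split; first by split=> //; split=> //; exact: W12loc0.
  apply: le_trans bd; apply: lee_wpmul2r; first by rewrite /L2norm Lnorm_ge0.
  rewrite lee_fin; have n0 : 0 < n.+1%:R :> R by rewrite ltr0n.
  have dl0 : 0 < `|delta / lambda| by rewrite normr_gt0.
  have dln : n.+1%:R * `|delta / lambda| <= 1.
    rewrite normrM normfV (gtr0_norm la0) mulrA ler_pdivrMr// mul1r mulrC.
    by rewrite -ler_pdivlMr.
  have sq : Num.sqrt n%:R <= n.+1%:R :> R.
    have -> : n.+1%:R = Num.sqrt (n.+1%:R ^+ 2) :> R by rewrite sqrtr_sqr gtr0_norm.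
    apply: ler_wsqrtr.
    by rewrite -natrX ler_nat (leq_trans (leqnSn n))// leq_pmulr.
  rewrite ler_pdivlMr ?mulr_gt0//.
  rewrite [leLHS](_ : _ = lambda * (Num.sqrt n%:R * `|delta / lambda|)); last by field.
  rewrite -[leRHS]mulr1; apply: ler_wpM2l; first exact: ltW.
  by apply: le_trans dln; apply: ler_wpM2r; first exact: ltW.
have [w Hw] := choice H.
exists (fun n => (w n).1.1.1), (fun n => (w n).1.1.2), (fun=> fun=> 0),
  (fun n => (w n).1.2), (fun n => (w n).2), (fun=> fun=> fun=> 0).
split; first by move=> n; have := Hw n; case: (w n) => [[[g v] Dv] D2v] [].
exists (lambda / 2) => [|n]; first by rewrite divr_gt0.
by have := Hw n; case: (w n) => [[[g v] Dv] D2v] [].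
Qed.

End Resonance.

Theorem theorem3p6 (R : realType) (lambda omega : R)
    (lambda_gt0 : 0 < lambda) (omega_gt0 : 0 < omega) :
  (exists s : nat -> R, counterexample lambda omega s) /\
  (forall alpha : R, 0 < alpha -> irrational (alpha / omega) ->
    exists s : nat -> R,
      [/\ counterexample lambda omega s,
          forall n, multiples alpha (s n) &
          dist (s n) (multiples omega) @[n --> \oo] --> (0 : R)]).
Proof.
have ln0 n : 0 < lambda / n.+1%:R by rewrite divr_gt0.
split.
  exists (fun n => omega * 1%:R + lambda / n.+1%:R).
  apply: counterexample_resonant => // n.
  by exists 0%N, (lambda / n.+1%:R); rewrite gt_eqF// gtr0_norm.
move=> alpha alpha0 irr.
have H n : exists zmd : nat * nat * R, let: (z, m, delta) := zmd in
    [/\ alpha * z%:R = omega * m.+1%:R + delta, delta != 0 &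
      `|delta| <= lambda / n.+1%:R].
  have [z [m [delta Hz]]] := small_linear_form alpha0 omega_gt0 irr (ln0 n).
  by exists (z, m, delta).
have [w Hw] := choice H.
exists (fun n => alpha * (w n).1.1%:R); split.
- apply: counterexample_resonant => // n.
  by have := Hw n; case: (w n) => [[z m] delta] Hz; exists m, delta.
- by move=> n; exists ((w n).1.1%:Z).
have ub n : 0 <= dist (alpha * (w n).1.1%:R) (multiples omega) <= lambda / n.+1%:R.
  have := Hw n; case: (w n) => [[z m] delta] [/= zE _ dle].
  have mem : [set `|alpha * z%:R - a| | a in multiples omega] `|delta|.
    exists (omega * (m.+1%:Z)%:~R); first by exists m.+1%:Z.
    by rewrite zE; congr `|_|; rewrite addrC addKr.
  apply/andP; split.
    apply: lb_le_inf; first by exists `|delta|.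
    by move=> _ [a _ <-].
  apply: le_trans dle; apply: ge_inf => //.
  by exists 0 => _ [a _ <-].
apply: (@squeeze_cvgr _ _ _ _ (fun=> 0) (fun n => lambda / n.+1%:R)).
- by near=> n; exact: ub.
- exact: cvg_cst.
- rewrite -(mulr0 lambda); apply: cvgM; first exact: cvg_cst.
  exact: cvg_harmonic.
Unshelve. all: by end_near. Qed.
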